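(* Let $m\ge 0$ and $n\ge 1$ be integers with $m\le n$, and let $p(z)=\sum_{k=-m}^{n} a_k z^k$, $z\in\mathbb{C}\setminus\{0\}$, be a Laurent polynomial with complex coefficients such that $a_{-m}a_n\neq 0$. Let $\mathbb{T}=\{z\in\mathbb{C}: |z|=1\}$, and identify $\mathbb{C}$ with $\mathbb{R}^2$ via $w=x+iy$. Then there exists a polynomial $h\in\mathbb{R}[x,y]$ of (total) degree $2n$, with zero set $V=\{(x,y)\in\mathbb{R}^2 : h(x,y)=0\}$, such that all of the following hold: (a) $p(\mathbb{T})\subset V$. (b) If $h$ is expressed as a polynomial $h_{\mathbb{C}}\in\mathbb{C}[w,\overline{w}]$ via the substitution $w=x+iy$ (that is, $h(x,y)=h_{\mathbb{C}}(x+iy,x-iy)$), then the degree of $h_{\mathbb{C}}$ in each of the variables $w$ and $\overline{w}$ separately is $m+n$. (c) If $m<n$, then the set $V\setminus p(\mathbb{T})$ is finite. (d) If $m=n$, then the set $V\setminus p(\mathbb{T})$ is finite if and only if $V$ is bounded.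
   Context: In $\mathbb{C}[w,\overline{w}]$ the symbols $w$ and $\overline{w}$ are treated as two independent variables. When $m=0$ the condition $a_{-m}\ne 0$ means $a_0\neq 0$. *)

(* Defs.v *)
From HB Require Import structures.
From mathcomp Require Import all_boot all_order all_algebra.
From mathcomp Require Import complex mpoly.
From mathcomp Require Import boolp classical_sets cardinality reals.
From mathcomp Require Import normedtype.

Set Implicit Arguments.
Unset Strict Implicit.
Unset Printing Implicit Defensive.

Import Order.TTheory GRing.Theory Num.Theory.
Import numFieldNormedType.Exports.

Local Open Scope classical_set_scope.
Local Open Scope ring_scope.
Local Open Scope complex_scope.

(* \sum_(k = -m)^n a_k z^k, with k = j - m; the values of [a] outside
   [-m, n] play no role. *)
Definition laurent (R : realType) (m n : nat) (a : int -> R[i]) (z : R[i]) :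
    R[i] :=
  \sum_(j < (m + n).+1) a (j%:Z - m%:Z) * z ^ (j%:Z - m%:Z).

Definition unit_circle (R : realType) : set R[i] := [set z | `|z| = 1].
Arguments unit_circle R : clear implicits.

Definition toR2 (R : realType) (w : R[i]) : R * R :=
  (complex.Re w, complex.Im w).

Definition zero_set (R : realType) (h : {mpoly R[2]}) : set (R * R) :=
  [set v | h.@[tnth [tuple v.1; v.2]] = 0].

(* [hC] is [h] written in the variables w = 'X_0 and \bar w = 'X_1: the
   identity h(x, y) = hC(x + iy, x - iy) holds in C[x, y]. As the substitution
   is an invertible linear change of variables, it determines [hC]. *)
Definition complex_form (R : realType)
    (h : {mpoly R[2]}) (hC : {mpoly R[i][2]}) : Prop :=
  map_mpoly (real_complex R) h =
  hC \mPo [tuple 'X_0 + 'i%C *: 'X_1; 'X_0 - 'i%C *: 'X_1].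

(* Degree in the single variable 'X_i (0 for the zero polynomial), as opposed
   to the total degree [(msize p).-1]. *)
Definition degree_in (n : nat) (K : nzRingType) (i : 'I_n)
    (p : {mpoly K[n]}) : nat :=
  \max_(u <- msupp p) u i.

(* Main.v *)
Require Import Defs.
From HB Require Import structures.
From mathcomp Require Import all_boot all_order all_algebra.
From mathcomp Require Import complex mpoly.
From mathcomp Require Import boolp classical_sets cardinality reals.
From mathcomp Require Import normedtype.
From mathcomp Require Import filter topology derive.
From mathcomp Require Import perm ring lra zify.

(** Put [P z = z^m * p(z)], of degree [N = m + n], and let [Q] be its conjugate
    reciprocal, so that [Q z = z^n * conj (p (1 / conj z))] for [z <> 0]. The
    polynomial [hC (w, v)] is the resultant in [z] of [P - w * z^m] and
    [Q - v * z^n], defined as the determinant of a Sylvester matrix of size [2N]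
    ([pencil_det]).

    Conjugation reverses the rows and the columns of this matrix and exchanges
    [w] and [v], so that [hC (x + i y, x - i y)] has real coefficients: this is
    [h] ([pencil_det_conj], [exists_real_form]). The degree in [w] is at most [N],
    as only [N] rows contain [w], and the total degree is at most [2n], as only
    [2n] columns contain [w] or [v]; in both cases the leading coefficient along a
    suitable line is again a determinant, which is nonzero because a vector in the
    left kernel is a pair of polynomials excluded by a divisibility argument
    ([coef_pencil_det_X], [coef_pencil_det_line]). The resultant vanishes at
    [(w, conj w)] exactly when [w = p(z) = p(1 / conj z)] for some [z]
    ([pencil_det_eq0]). Hence the zero set [V] contains the image of the circle, and
    its other points come from the zeros in the punctured disc of the harmonic
    function [f(z) = p(z) - p(1 / conj z)], which vanishes on the circle.

    It remains to see that [f] has finitely many zeros in the disc as soon as it has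
    none near the centre ([finite_common_zeros]). Up to the positive factor
    [|z|^(2n)], the real and imaginary parts of [f] are real polynomials in [x] and
    [y]; let [g] be their greatest common divisor, so that the zeros of [f] are
    those of [g], apart from finitely many vertical lines ([bivariate_gcd]). Near the
    centre [g] has a constant sign, say positive. If [g] were negative somewhere in
    the disc, then [f] would vanish on the boundary of the region where [g < 0],
    hence inside, by the maximum principle ([nonneg_in_disc]), which is impossible.
    So [g >= 0] on the disc, and [f] vanishes to second order at every zero of [g]:
    these zeros are critical points of a nonconstant rational function
    ([second_order_zero]), and there are finitely many of them.

    When [m < n] the term [a_n * (1 / conj z)^n] dominates [f] near [0], so that [f]
    has no zeros there ([no_symmetric_pair_lt]). When [m = n] the values of [p] at zeros of
    [f] tending to [0] would tend to infinity, so the same holds if [V] is bounded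
    ([no_symmetric_pair_bounded]); conversely the image of the circle is bounded. *)

Import Order.TTheory GRing.Theory Num.Theory.
Import numFieldNormedType.Exports.

Local Open Scope classical_set_scope.
Local Open Scope ring_scope.

Set Implicit Arguments.
Unset Strict Implicit.
Unset Printing Implicit Defensive.

(** * Degree of a determinant *)

Section DetDegree.

Lemma size_coef_prod (K : nzRingType) (I : Type) (r : seq I) (F : I -> {poly K})
    (d : I -> nat) :
  (forall i, (size (F i) <= (d i).+1)%N) ->
  (size (\prod_(i <- r) F i)%R <= (\sum_(i <- r) d i).+1)%N /\
  (\prod_(i <- r) F i)`_(\sum_(i <- r) d i)%N = \prod_(i <- r) (F i)`_(d i).
Proof.
move=> Fd; elim: r => [|i r [IHs IHc]]; first by rewrite !big_nil size_poly1 coef1.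
rewrite !big_cons; split.
  by apply: (leq_trans (size_polyMleq _ _)); have := Fd i; lia.
rewrite coefM (bigD1 (inord (d i))) //= inordK ?ltnS ?leq_addr //.
rewrite addKn IHc [X in _ + X]big1 ?addr0 // => j nj.
have {}nj : (j : nat) != d i.
  by apply: contra nj => /eqP E; apply/eqP/val_inj; rewrite /= inordK // ltnS leq_addr.
case: (ltngtP j (d i)) nj => // jd _.
  by rewrite [X in _ * X]nth_default ?mulr0 //; apply: (leq_trans IHs); lia.
by rewrite nth_default ?mul0r //; apply: leq_trans (Fd i) _.
Qed.

(** If column [j] has degree at most [d j], the coefficient of the determinant in
    degree [\sum_j d j] is the determinant of the matrix of leading coefficients. *)
Lemma size_coef_det (K : comNzRingType) (k : nat) (A : 'M[{poly K}]_k)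
    (d : 'I_k -> nat) :
  (forall i j, (size (A i j) <= (d j).+1)%N) ->
  (size (\det A) <= (\sum_j d j).+1)%N /\
  (\det A)`_(\sum_j d j)%N = \det (\matrix_(i, j) (A i j)`_(d j)).
Proof.
move=> Ad; rewrite -(det_tr A) -(det_tr (\matrix_(i, j) _)).
have AT i j : (size (A^T i j) <= (d i).+1)%N by rewrite mxE.
have prodP (s : perm.perm_of 'I_k) :=
  size_coef_prod (index_enum 'I_k) (fun i => AT i (s i)).
split.
  rewrite /determinant; apply: (leq_trans (size_sum _ _ _)).
  apply/bigmax_leqP => s _.
  by rewrite -signr_odd; case: (odd _); rewrite ?expr1 ?expr0 ?mulN1r ?size_polyN
    ?mul1r; case: (prodP s).
rewrite /determinant coef_sum; apply: eq_bigr => s _.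
have -> : ((-1) ^+ s : {poly K}) = ((-1) ^+ s)%:P by rewrite polyC_exp polyCN.
by rewrite coefCM (prodP s).2; congr (_ * _); apply: eq_bigr => i _; rewrite !mxE.
Qed.

Lemma mmeasureM_leq (n : nat) (K : nzRingType) (mf : measure n)
    (p q : {mpoly K[n]}) (a b : nat) :
  (mmeasure mf p <= a.+1)%N -> (mmeasure mf q <= b.+1)%N ->
  (mmeasure mf (p * q) <= (a + b).+1)%N.
Proof.
move=> pa qb; rewrite [leqLHS]mmeasureE; apply/bigmax_leqP_seq => u.
move/msuppM_le => /allpairsP[[u1 u2] /= [h1 h2 ->]] _; rewrite mfD ltnS.
by apply: leq_add; rewrite -ltnS; [apply: leq_trans pa|apply: leq_trans qb];
  exact: mmeasure_mnm_lt.
Qed.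

Lemma mmeasure_det (n : nat) (K : comNzRingType) (mf : measure n) (k : nat)
    (A : 'M[{mpoly K[n]}]_k) (d : 'I_k -> nat) :
  (forall i j, (mmeasure mf (A i j) <= (d j).+1)%N) ->
  (mmeasure mf (\det A) <= (\sum_j d j).+1)%N.
Proof.
move=> Ad; rewrite -(det_tr A) /determinant.
apply: (leq_trans (mmeasure_sum _ _ _ _)); apply/bigmax_leqP => s _.
have prodP : (mmeasure mf (\prod_i A^T i (s i))%R <= (\sum_i d i).+1)%N.
  elim: (index_enum _) => [|i r IH]; first by rewrite !big_nil mmeasure1.
  by rewrite !big_cons; apply: mmeasureM_leq => //; rewrite mxE.
by rewrite -signr_odd; case: (odd _); rewrite ?expr1 ?expr0 ?mulN1r ?mmeasureN ?mul1r.
Qed.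

End DetDegree.

(** * Sylvester matrices *)

Section Sylvester.

(** The [2N] x [2N] Sylvester matrix of two polynomials regarded as having
    degree at most [N], whatever their actual degrees: its rows are the
    coefficients of ['X^i * p] and ['X^i * q] for [i < N]. *)
Definition sylvester (S : nzRingType) (N : nat) (p q : {poly S}) : 'M[S]_(N + N) :=
  col_mx (\matrix_(i < N, j < N + N) ('X^i * p)`_j)
         (\matrix_(i < N, j < N + N) ('X^i * q)`_j).

Lemma map_sylvester (S S' : nzRingType) (f : {rmorphism S -> S'}) N
    (p q : {poly S}) :
  map_mx f (sylvester N p q) = sylvester N (map_poly f p) (map_poly f q).
Proof.
rewrite /sylvester map_col_mx; congr col_mx;
by apply/matrixP => i j; rewrite !mxE -coef_map rmorphM /= map_polyXn.
Qed.

(** A row vector on the left stands for a pair [(u, v)] of polynomials of degree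
    less than [N]; its image is [u * p + v * q]. *)
Lemma mul_sylvester (S : comNzRingType) N (p q : {poly S}) (u v : 'rV[S]_N) :
  row_mx u v *m sylvester N p q =
  \row_j (rVpoly u * p + rVpoly v * q)`_j.
Proof.
rewrite mul_row_col; apply/rowP => j; rewrite !mxE coefD.
have E (a : 'rV[S]_N) (r : {poly S}) :
    \sum_i a 0 i * (\matrix_(i < N, j < N + N) ('X^i * r)`_j) i j =
    (rVpoly a * r)`_j.
  rewrite [in RHS](row_sum_delta a) linear_sum mulr_suml coef_sum.
  by apply: eq_bigr => i _; rewrite mxE linearZ /= rVpoly_delta -scalerAl coefZ.
by rewrite !E.
Qed.

(** Determinant criterion for a matrix whose rows are indexed by the monomials
    of a pair of polynomials [(u, v)] of degree less than [N]. *)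
Lemma det_row_mx_neq0 (F : fieldType) N (A : 'M[F]_(N + N)) :
  (forall u v : {poly F}, (size u <= N)%N -> (size v <= N)%N ->
     row_mx (poly_rV u) (poly_rV v) *m A = 0 -> u = 0 /\ v = 0) ->
  \det A != 0.
Proof.
move=> H; apply/det0P => -[w w0 wA0].
have := H (rVpoly (lsubmx w)) (rVpoly (rsubmx w)) (size_poly _ _) (size_poly _ _).
rewrite !rVpolyK hsubmxK => /(_ wA0)[u0 v0]; case/eqP: w0.
by rewrite -[w]hsubmxK -[lsubmx w]rVpolyK -[rsubmx w]rVpolyK u0 v0 linear0 row_mx0.
Qed.

Lemma det_sylvester_eq0 (F : fieldType) N (p q : {poly F}) :
  (size p <= N.+1)%N -> (size q <= N.+1)%N -> \det (sylvester N p q) = 0 ->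
  exists uv : {poly F} * {poly F},
    [/\ (size uv.1 <= N)%N, (size uv.2 <= N)%N,
        (uv.1 != 0) || (uv.2 != 0) & uv.1 * p + uv.2 * q = 0].
Proof.
move=> sp sq /eqP/det0P[w w0 wA0].
exists (rVpoly (lsubmx w), rVpoly (rsubmx w)); split; rewrite ?size_poly //=.
  rewrite -negb_and; apply: contra w0 => /andP[/eqP u0 /eqP v0].
  by rewrite -[w]hsubmxK -[lsubmx w]rVpolyK -[rsubmx w]rVpolyK u0 v0 linear0 row_mx0.
move: wA0; rewrite -{1}[w]hsubmxK mul_sylvester => /rowP H.
apply/polyP => j; rewrite coef0; case: (ltnP j (N + N)) => jN.
  by have := H (Ordinal jN); rewrite !mxE.
have sz (a : 'rV[F]_N) (r : {poly F}) : (size r <= N.+1)%N ->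
    (size (rVpoly a * r)%R <= j)%N.
  move=> sr; apply: (leq_trans (size_polyMleq _ _)).
  have : (size (rVpoly a) <= N)%N by exact: size_poly.
  lia.
by rewrite coefD !nth_default ?addr0 // sz.
Qed.

(** A common root gives a vector in the right kernel of the Sylvester matrix. *)
Lemma det_sylvester_root (F : fieldType) N (p q : {poly F}) (z : F) :
  (0 < N)%N -> (size p <= N.+1)%N -> (size q <= N.+1)%N ->
  root p z -> root q z -> \det (sylvester N p q) = 0.
Proof.
move=> N0 sp sq pz qz; apply/eqP; rewrite -det_tr; apply/det0P.
exists (\row_j z ^+ j).
  apply/eqP => /rowP /(_ (Ordinal (ltn_addr N N0))); rewrite !mxE expr0 => /eqP.
  by rewrite oner_eq0.
have sz (i : 'I_N) (r : {poly F}) : (size r <= N.+1)%N -> root r z ->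
    \sum_(j < N + N) z ^+ j * ('X^i * r)`_j = 0.
  move=> sr /eqP rz; transitivity ('X^i * r).[z]; last by rewrite hornerM rz mulr0.
  rewrite (@horner_coef_wide _ (N + N) _ z).
    by apply: eq_bigr => j _; rewrite mulrC.
  by apply: (leq_trans (size_polyMleq _ _)); rewrite size_polyXn; have := ltn_ord i; lia.
apply/rowP => i; rewrite !mxE.
under eq_bigr do rewrite !mxE.
case: (split i) => k.
  by under eq_bigr do rewrite !mxE; rewrite sz.
by under eq_bigr do rewrite !mxE; rewrite sz.
Qed.

(** Over an algebraically closed field, a singular Sylvester matrix comes from
    a common root, provided one of the polynomials has full degree. *)
Lemma det_sylvester_common_root (F : closedFieldType) N (p q : {poly F}) :
  size p = N.+1 -> (size q <= N.+1)%N -> \det (sylvester N p q) = 0 ->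
  exists2 z, root p z & root q z.
Proof.
move=> sp sq /(det_sylvester_eq0 (eq_leq sp) sq) [[u v] /= [su sv uv0 E]].
have p0 : p != 0 by rewrite -size_poly_gt0 sp.
case: (boolP (coprimep p q)) => [cop | ncop].
  have pv : p %| v.
    have : p %| v * q by rewrite -(dvdp_addr _ (dvdp_mull u (dvdpp p))) E dvdp0.
    by rewrite mulrC Gauss_dvdpr.
  have v0 : v = 0.
    apply/eqP; apply: contraTT pv => v0; rewrite gtNdvdp ?sp ?ltnS //.
  move: E uv0; rewrite v0 mul0r addr0 eqxx orbF => E; move/eqP: E.
  by rewrite mulf_eq0 (negbTE p0) orbF => /eqP ->; rewrite eqxx.
have : (size (gcdp p q) != 1)%N by rewrite -/(coprimep p q).
case/closed_rootP => z; rewrite root_gcd => /andP[]; by exists z.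
Qed.

End Sylvester.

(** * The resultant as a function of two parameters *)

Section Pencil.

(** The resultant of [p - w *: 'X^m] and [q - v *: 'X^n], both regarded as
    having degree [m + n], as a function of the two parameters [w] and [v]. *)
Definition pencil_det (S : comNzRingType) (m n : nat) (p q : {poly S}) (w v : S) : S :=
  \det (sylvester (m + n) (p - w *: 'X^m) (q - v *: 'X^n)).

Lemma rmorph_pencil_det (S S' : comNzRingType) (f : {rmorphism S -> S'}) m n
    (p q : {poly S}) (w v : S) :
  f (pencil_det m n p q w v) =
  pencil_det m n (map_poly f p) (map_poly f q) (f w) (f v).
Proof.
by rewrite /pencil_det -det_map_mx map_sylvester !rmorphB /= !map_polyZ /= !map_polyXn.
Qed.

Lemma sylvesterE (S : nzRingType) N (p q : {poly S}) (i j : 'I_(N + N)) :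
  sylvester N p q i j =
  if (i < N)%N then (if (j < i)%N then 0 else p`_(j - i))
  else (if (j < i - N)%N then 0 else q`_(j - (i - N))).
Proof.
rewrite /sylvester !mxE; case: splitP => k ->; rewrite mxE coefXnM ?ltn_ord //.
by rewrite addKn.
Qed.

(** Reversing the order of the rows and of the columns of a Sylvester matrix
    exchanges the two polynomials and reverses their coefficients. *)
Lemma pencil_det_rev (S : comNzRingType) m n (p q p' q' : {poly S}) (w v : S) :
  (forall j, p'`_j = if (j <= m + n)%N then q`_(m + n - j) else 0) ->
  (forall j, q'`_j = if (j <= m + n)%N then p`_(m + n - j) else 0) ->
  (size p <= (m + n).+1)%N -> (size q <= (m + n).+1)%N ->
  pencil_det m n p' q' v w = pencil_det m n p q w v.
Proof.
move=> pE qE sp sq; rewrite /pencil_det; set M := sylvester _ (p - _) _.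
have -> : sylvester (m + n) (p' - v *: 'X^m) (q' - w *: 'X^n) =
    row_perm (perm (@rev_ord_inj _)) (col_perm (perm (@rev_ord_inj _)) M).
  apply/matrixP => i j; rewrite [RHS]mxE [RHS]mxE !permE !sylvesterE /=.
  have iN : (i < m + n + (m + n))%N := ltn_ord i; have jN : (j < m + n + (m + n))%N :=
    ltn_ord j.
  move: (nat_of_ord i) (nat_of_ord j) iN jN => {}i {}j iN jN.
  move: pE qE sp sq iN jN {M}; move EN : (m + n)%N => N pE qE sp sq iN jN.
  rewrite !coefD !coefN !coefZ !coefXn pE qE -/N.
  have z1 k : (N < k)%N -> p`_k = 0 by move=> h; rewrite nth_default ?(leq_trans sp h).
  have z2 k : (N < k)%N -> q`_k = 0 by move=> h; rewrite nth_default ?(leq_trans sq h).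
  have F (b : bool) : ~ b -> b = false by move/negP/negbTE.
  case: (ltnP i N) => hi.
    have -> : (N + N - i.+1 < N)%N = false by apply: F; lia.
    case: (ltnP j i) => ji.
      case: ifP => // h; rewrite z2; last by lia.
      by rewrite [X in (nat_of_bool X)%:R]F ?mulr0 ?subr0 //; lia.
    case: (leqP (j - i) N) => jk.
      rewrite [in RHS](F (_ < _)%N); last by lia.
      by congr (_`_ _ - _ * (_ : bool)%:R); lia.
    rewrite [in RHS](_ : (_ < _)%N = true); last by lia.
    by rewrite [X in (nat_of_bool X)%:R]F ?mulr0 ?subr0 //; lia.
  have -> : (N + N - i.+1 < N)%N by lia.
  case: (ltnP j (i - N)) => ji.
    case: ifP => // h; rewrite z1; last by lia.
    by rewrite [X in (nat_of_bool X)%:R]F ?mulr0 ?subr0 //; lia.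
  case: (leqP (j - (i - N)) N) => jk.
    rewrite [in RHS](F (_ < _)%N); last by lia.
    by congr (_`_ _ - _ * (_ : bool)%:R); lia.
  rewrite [in RHS](_ : (_ < _)%N = true); last by lia.
  by rewrite [X in (nat_of_bool X)%:R]F ?mulr0 ?subr0 //; lia.
rewrite row_permE col_permE !det_mulmx !det_perm odd_permV mulrCA.
by rewrite -signr_addb addbb mulr1.
Qed.

End Pencil.

(** * Degree of the resultant along a line *)

Section PencilDegree.

Lemma sum_ord_ltn N k : (\sum_(j < k) (j < N))%N = minn k N.
Proof. by elim: k => [|k IH]; rewrite ?big_ord0 ?min0n // big_ord_recr /= IH; lia. Qed.

Lemma sum_ord_itv a b k : (\sum_(j < k) (a <= j < b))%N = (minn k b - a)%N.
Proof. by elim: k => [|k IH]; rewrite ?big_ord0 ?min0n // big_ord_recr /= IH; lia. Qed.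

Lemma size_polyC_subZX (F : fieldType) (c lam : F) (b : bool) :
  (size (c%:P - lam *: 'X * b%:R)%R <= b.+1)%N.
Proof.
case: b; rewrite ?mulr0 ?subr0 ?size_polyC_leq1 // mulr1.
apply: (leq_trans (size_polyD _ _)); rewrite size_polyN geq_max.
rewrite (leq_trans (size_polyC_leq1 _)) //.
by apply: (leq_trans (size_scale_leq _ _)); rewrite size_polyX.
Qed.

Lemma size_mul_bound (S : nzRingType) (p q : {poly S}) (a b k : nat) :
  (size p <= a)%N -> (size q <= b.+1)%N -> (a + b <= k)%N -> (size (p * q)%R <= k)%N.
Proof.
move=> sp sq abk; apply: (leq_trans (size_polyMleq _ _)).
by case: (size q) sq => [|c] sq; lia.
Qed.

(** If [t] has degree [l] and [t(0) <> 0], a nonzero multiple of [t] cannot have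
    all its nonzero coefficients in degrees [k <= j < k + l]. *)
Lemma mul_band_eq0 (F : fieldType) (k l : nat) (t v : {poly F}) :
  size t = l.+1 -> t`_0 != 0 -> (forall j, (j < k)%N -> (v * t)`_j = 0) ->
  (size (v * t)%R <= k + l)%N -> v = 0.
Proof.
move=> st t0 low high.
have t_neq0 : t != 0 by rewrite -size_poly_gt0 st.
have : 'X^k %| v.
  rewrite -(@Gauss_dvdpl _ _ t) ?coprimep_expl //; last first.
    by rewrite coprimep_sym -['X]subr0 -polyC0 coprimep_XsubC /root horner_coef0.
  rewrite -[v * t](@poly_take_drop _ k) dvdp_addl ?dvdp_mull //.
  rewrite (_ : take_poly k _ = 0) ?dvdp0 //.
  by apply/polyP => j; rewrite coef_take_poly coef0; case: ifP => // /low.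
move/dvdpP => [v' E]; apply/eqP; apply: contraTT high => v0.
have v'0 : v' != 0 by apply: contraNneq v0 => v'0; rewrite E v'0 mul0r.
have Xk : 'X^k != 0 :> {poly F} by rewrite monic_neq0 ?monicXn.
rewrite E size_mul ?mulf_neq0 // size_mul // size_polyXn st.
by move: v'0; rewrite -size_poly_gt0; case: (size v') => // s _; lia.
Qed.

(** The resultant at [(t, 0)] has a nonzero coefficient in degree [m + n]: the rows of index less than [m + n] have degree one, and
    the leading coefficients form the Sylvester matrix of [- 'X^m] and [q]. *)
Lemma coef_pencil_det_X (F : fieldType) m n (p q : {poly F}) :
  (0 < m + n)%N -> (size p <= (m + n).+1)%N -> size q = (m + n).+1 -> q`_0 != 0 ->
  (pencil_det m n (map_poly polyC p) (map_poly polyC q) 'X 0)`_(m + n) != 0.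
Proof.
move=> N0 sp sq q0; rewrite /pencil_det -det_tr.
set N := (m + n)%N; set A := (_^T)%R.
have Ad i j : (size (A i j) <= (j < N : nat).+1)%N.
  rewrite mxE sylvesterE scale0r subr0; case: (ltnP j N) => _.
    case: ifP => _; rewrite ?size_poly0 // coefB coefZ coef_map coefXn.
    rewrite -['X]scale1r; apply: (leq_trans (size_polyC_subZX _ _ _)).
    by case: (_ == _).
  by case: ifP => _; rewrite ?size_poly0 // coef_map size_polyC leq_b1.
have [_] := size_coef_det Ad.
rewrite sum_ord_ltn (minn_idPr _) ?leq_addr // => ->.
rewrite -det_tr (_ : _^T = sylvester N (- 'X^m) q); last first.
  apply/matrixP => i j; rewrite [LHS]mxE [LHS]mxE /A [(_^T)%R _ _]mxE !sylvesterE scale0r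
    subr0.
  case: (ltnP i N) => _; case: ifP => _; rewrite ?coef0 //.
    by rewrite coefB coefN coefZ coef_map coefB coefC /= sub0r !coefXn;
       case: (_ == _); rewrite ?mulr1 ?mulr0 ?coefX ?coef0.
  by rewrite coef_map coefC.
apply: det_row_mx_neq0 => u v su sv.
rewrite mul_sylvester !poly_rV_K // => /rowP H.
have E : v * q = u * 'X^m.
  apply/eqP; rewrite -subr_eq0 addrC -mulrN; apply/eqP/polyP => j; rewrite coef0.
  case: (ltnP j (N + N)) => jN; first by have := H (Ordinal jN); rewrite !mxE.
  rewrite coefD !nth_default ?addr0 //.
    by apply: (size_mul_bound sv (b := N)) jN; rewrite sq.
  by apply: (size_mul_bound su (b := N)) jN; rewrite size_polyN size_polyXn /N; lia.
have v0 : v = 0.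
  apply: (@mul_band_eq0 F m N q v) => //.
    by move=> j jm; rewrite E coefMXn jm.
  by rewrite E; apply: (size_mul_bound su (b := m)); rewrite ?size_polyXn // addnC.
split=> //; apply/eqP; have /eqP := esym E; rewrite v0 mul0r mulf_eq0.
by rewrite (negbTE (monic_neq0 (monicXn _ _))) orbF.
Qed.

(** Along the line [(w, v) = (t, lam * t)] the pencil determinant has a
    nonzero coefficient in degree [2 * n]: only the columns of index [m <= j < m + 2 * n] of the
    Sylvester matrix depend on [t]. A pair [(u, v)] in the left kernel of the
    matrix of leading coefficients satisfies [u = - lam * X^(n - m) * v], so that
    all nonzero coefficients of [v * (q - lam * X^(n - m) * p)] have
    these indices, which forces [v = 0]. *)
Lemma coef_pencil_det_line (F : fieldType) m n (p q : {poly F}) (lam : F) :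
  (m <= n)%N -> (0 < n)%N ->
  (size p <= (m + n).+1)%N -> (size q <= (m + n).+1)%N -> lam != 0 ->
  (q - lam *: ('X^(n - m) * p))`_0 != 0 ->
  (q - lam *: ('X^(n - m) * p))`_(2 * n) != 0 ->
  (pencil_det m n (map_poly polyC p) (map_poly polyC q) 'X (lam *: 'X))`_(2 * n) != 0.
Proof.
move=> mn n0 sp sq lam0; set t := q - _ => t0 tn; rewrite /pencil_det.
set N := (m + n)%N; set A := sylvester _ _ _.
have st : size t = (2 * n).+1.
  apply/eqP; rewrite eqn_leq; apply/andP; split; last first.
    by rewrite ltnNge; apply: contra tn => h; rewrite nth_default.
  apply: (leq_trans (size_polyD _ _)); rewrite size_polyN geq_max; apply/andP; split.
    by apply: (leq_trans sq); lia.
  apply: (leq_trans (size_scale_leq _ _)); rewrite mulrC.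
  by apply: (size_mul_bound sp (b := n - m)); rewrite ?size_polyXn //; lia.
have Ad i j : (size (A i j) <= (m <= j < m + 2 * n : nat).+1)%N.
  rewrite /A sylvesterE -/N.
  move: (nat_of_ord i) (nat_of_ord j) (ltn_ord i) (ltn_ord j) => {}i {}j iN jN.
  case: (ltnP i N) => hi.
    case: (ltnP j i) => ji; first by rewrite size_poly0.
    rewrite coefB coefZ coef_map coefXn -['X]scale1r.
    apply: (leq_trans (size_polyC_subZX _ _ _)); case: eqP => // h.
    by rewrite (_ : (_ <= _ < _)%N = true) //; move: iN jN; rewrite /N; lia.
  case: (ltnP j (i - N)) => ji; first by rewrite size_poly0.
  rewrite coefB coefZ coef_map coefXn.
  apply: (leq_trans (size_polyC_subZX _ _ _)); case: eqP => // h.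
  by rewrite (_ : (_ <= _ < _)%N = true) //; move: iN jN; rewrite /N; lia.
have [_] := size_coef_det Ad.
rewrite sum_ord_itv (_ : (_ - m)%N = (2 * n)%N); last by rewrite /N; lia.
move=> ->; apply: det_row_mx_neq0 => u v su sv /rowP H.
(* outside the band the entries are constant, inside only the terms in [t] count *)
have top j : (j < N + N)%N ->
   (if (m <= j < m + 2 * n)%N then - (u * 'X^m + lam *: v * 'X^n)`_j
     else (u * p + v * q)`_j) = 0.
  move=> jN; have := H (Ordinal jN); rewrite [RHS]mxE; apply: etrans.
  case: ifP => hj.
    have -> : - (u * 'X^m + lam *: v * 'X^n)`_j =
       (row_mx (poly_rV u) (poly_rV v) *m sylvester N (- 'X^m) (- (lam *: 'X^n))) 0
         (Ordinal jN).
      rewrite mul_sylvester !mxE !poly_rV_K //=.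
      by rewrite -coefN opprD !mulrN -!scalerAl -scalerAr.
    rewrite !mxE; apply: eq_bigr => i _; congr (_ * _).
    rewrite [RHS]mxE hj /A !sylvesterE; case: ifP => _; case: ifP => _;
      rewrite ?coef0 // coefN coefB !coefZ coef_map coefB coefC /= sub0r ?coefXn;
      by case: (_ == _); rewrite ?mulr1 ?mulr0 ?coefZ ?coefX ?coef0 ?mulr1.
  have -> : (u * p + v * q)`_j =
     (row_mx (poly_rV u) (poly_rV v) *m sylvester N p q) 0 (Ordinal jN).
    by rewrite mul_sylvester !mxE !poly_rV_K.
  rewrite !mxE; apply: eq_bigr => i _; congr (_ * _).
  rewrite [RHS]mxE hj /A !sylvesterE; case: ifP => _; case: ifP => _;
    rewrite ?coef0 // coefB coefZ coef_map coefB coefC coefXn /=;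
    by case: (_ == _); rewrite ?mulr1 ?mulr0 ?coefZ ?coefX ?coef0 ?mulr0 ?subr0.
have E1 : u * 'X^m + lam *: v * 'X^n = 0.
  apply/polyP => j; rewrite coef0.
  case: (ltnP j m) => jm.
    by rewrite coefD !coefMXn jm (leq_trans jm mn) addr0.
  case: (ltnP j (m + 2 * n)) => jn; last first.
    rewrite coefD !nth_default ?addr0 //.
      apply: (@size_mul_bound _ _ _ N n); rewrite ?size_scale ?size_polyXn //.
      by move: jn; rewrite /N; lia.
    apply: (size_mul_bound su (b := m)); rewrite ?size_polyXn //.
    by move: jn; rewrite /N; lia.
  have /eqP := top j ltac:(rewrite /N; lia); rewrite jm jn oppr_eq0 => /eqP //.
have E2 : u = - lam *: ('X^(n - m) * v).
  have /eqP := E1; rewrite -{1}(subnK mn) exprD mulrA -mulrDl mulf_eq0.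
  rewrite (negbTE (monic_neq0 (monicXn _ _))) orbF addr_eq0 => /eqP ->.
  by rewrite scaleNr -scalerAl mulrC.
have E3 : u * p + v * q = v * t.
  rewrite /t E2 mulrBr -scalerAl addrC scaleNr; congr (_ - _).
  by rewrite -scalerAr; congr (_ *: _); rewrite mulrA [v * _]mulrC.
have v0 : v = 0.
  apply: (@mul_band_eq0 F m (2 * n) t v) => //.
    move=> j jm; rewrite -E3; have := top j ltac:(rewrite /N; lia).
    by rewrite leqNgt jm.
  apply/leq_sizeP => j jm; rewrite -E3; case: (ltnP j (N + N)) => jN.
    by have := top j jN; rewrite [(j < _)%N]ltnNge jm andbF.
  by rewrite coefD !nth_default ?addr0 //; [apply: size_mul_bound sv sq jN|apply:
    size_mul_bound su sp jN].
by rewrite E2 v0 mulr0 scaler0.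
Qed.

End PencilDegree.

(** * Degrees of multivariate polynomials *)

Section MultivariateDegree.

(** Substituting polynomials in one variable does not increase the degree, if
    each variable is replaced by a polynomial of degree at most its weight. *)
Lemma size_mmap_leq (n : nat) (K : comNzRingType) (mf : measure n)
    (f : 'I_n -> {poly K}) (p : {mpoly K[n]}) :
  (forall i, (size (f i) <= (mf U_(i)%MM).+1)%N) ->
  (size (mmap polyC f p) <= mmeasure mf p)%N.
Proof.
move=> fd; rewrite /mmap; apply: (leq_trans (size_sum _ _ _)).
apply/bigmax_leqP_seq => u up _; rewrite mul_polyC.
apply: (leq_trans (size_scale_leq _ _)).
apply: leq_trans (mmeasure_mnm_lt mf up).
rewrite /mmap1 mfE.
have [] // := @size_coef_prod K _ (index_enum 'I_n) (fun i => f i ^+ u i)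
   (fun i => u i * mf U_(i)%MM)%N.
move=> i; elim: (u i) => [|k IH]; first by rewrite size_poly1.
rewrite exprS [f i * _]mulrC; apply: (size_mul_bound IH (fd i)).
by rewrite mulSn addSn addnC.
Qed.

Lemma mmeasure_map_inj (n : nat) (K K' : nzRingType) (f : {rmorphism K -> K'})
    (mf : measure n) (p : {mpoly K[n]}) :
  injective f -> mmeasure mf (map_mpoly f p) = mmeasure mf p.
Proof.
by move=> fI; rewrite !mmeasureE (perm_big _ (msupp_map_mpoly p fI)).
Qed.

(** The exponent of the variable of index [i], as a grading of the monomials. *)
Definition mnm_at (n : nat) (i : 'I_n) (u : 'X_{1..n}) : nat := u i.

Lemma mnm_at0 n i : @mnm_at n i 0%MM = 0%N. Proof. exact: mnm0E. Qed.

Lemma mnm_atD n i : {morph @mnm_at n i : u v / (u + v)%MM >-> (u + v)%N}.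
Proof. by move=> u v; exact: mnmDE. Qed.

HB.instance Definition _ n i := isMeasure.Build n (@mnm_at n i) (@mnm_at0 n i) (@mnm_atD
  n i).

Lemma degree_inE (n : nat) (K : nzRingType) (i : 'I_n) (p : {mpoly K[n]}) (d : nat) :
  mmeasure (@mnm_at n i) p = d.+1 -> degree_in i p = d.
Proof.
rewrite mmeasureE /degree_in => H; apply/eqP; rewrite eqn_leq; apply/andP; split.
  apply/bigmax_leqP_seq => u up _; rewrite -ltnS -H.
  exact: (@leq_bigmax_seq _ _ _ (fun m => (mnm_at i m).+1) u).
rewrite -ltnS -H; apply/bigmax_leqP_seq => u up _; rewrite ltnS.
exact: (@leq_bigmax_seq _ _ _ (fun m => mnm_at i m) u).
Qed.

Section PencilMeasure.
Variables (k : nat) (K : comNzRingType) (mf : measure k).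
Variables (m n : nat) (p q : {poly K}) (w v : {mpoly K[k]}).
Let P := map_poly (@mpolyC k K) p.
Let Q := map_poly (@mpolyC k K) q.

Let entry_leq (c : K) (b : bool) (w' : {mpoly K[k]}) (d : nat) :
  (mmeasure mf w' <= d.+1)%N ->
  (mmeasure mf (c%:MP_[k] - w' * b%:R) <= (b * d).+1)%N.
Proof.
move=> wd; apply: (leq_trans (mmeasureD_le _ _ _)); rewrite geq_max.
rewrite mmeasureN mmeasureC (leq_trans (leq_b1 _)) //=.
by case: b; rewrite ?mulr1 ?mul1n // mulr0 mmeasure0.
Qed.

Lemma mmeasure_pencil_rows :
  (mmeasure mf w <= 2)%N -> (mmeasure mf v <= 1)%N ->
  (mmeasure mf (pencil_det m n P Q w v) <= (m + n).+1)%N.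
Proof.
move=> w2 v1; rewrite /pencil_det -det_tr; set N := (m + n)%N.
have := @mmeasure_det k K mf (N + N) (sylvester N (P - w *: 'X^m) (Q - v *: 'X^n))^T
  (fun j => (j < N)%N).
rewrite sum_ord_ltn (minn_idPr _) ?leq_addr //; apply => i j.
rewrite mxE sylvesterE; case: (ltnP j N) => _; case: ifP => _; rewrite ?mmeasure0 //;
  rewrite coefB coefZ coef_map coefXn.
  by apply: (leq_trans (entry_leq _ _ w2)); case: (_ == _).
by apply: (leq_trans (entry_leq _ _ v1)); rewrite muln0.
Qed.

Lemma mmeasure_pencil_cols :
  (m <= n)%N -> (mmeasure mf w <= 2)%N -> (mmeasure mf v <= 2)%N ->
  (mmeasure mf (pencil_det m n P Q w v) <= (2 * n).+1)%N.
Proof.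
move=> mn w2 v2; rewrite /pencil_det; set N := (m + n)%N.
have := @mmeasure_det k K mf (N + N) (sylvester N (P - w *: 'X^m) (Q - v *: 'X^n))
  (fun j => (m <= j < m + 2 * n)%N).
rewrite sum_ord_itv (_ : (_ - m)%N = (2 * n)%N); last by rewrite /N; lia.
apply => i j; rewrite sylvesterE.
move: (nat_of_ord i) (nat_of_ord j) (ltn_ord i) (ltn_ord j) => {}i {}j iN jN.
case: (ltnP i N) => hi.
  case: (ltnP j i) => ji; first by rewrite mmeasure0.
  rewrite coefB coefZ coef_map coefXn.
  apply: (leq_trans (entry_leq _ _ w2)); case: eqP => // h.
  by rewrite (_ : (_ <= _ < _)%N = true) //; move: iN jN; rewrite /N; lia.
case: (ltnP j (i - N)) => ji; first by rewrite mmeasure0.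
rewrite coefB coefZ coef_map coefXn.
apply: (leq_trans (entry_leq _ _ v2)); case: eqP => // h.
by rewrite (_ : (_ <= _ < _)%N = true) //; move: iN jN; rewrite /N; lia.
Qed.

End PencilMeasure.

End MultivariateDegree.

(** * The real polynomial *)

Section RealForm.
Local Open Scope complex_scope.
Variable R : realType.
Implicit Types p : {poly R[i]}.

(** The polynomial [z^N * conj (p (1 / conj z))]: the conjugate reciprocal of [p],
    regarded as having degree [N]. *)
Definition conj_rev (N : nat) (p : {poly R[i]}) : {poly R[i]} :=
  \poly_(j < N.+1) conjc p`_(N - j).

Lemma coef_conj_rev N p j :
  (conj_rev N p)`_j = if (j <= N)%N then conjc p`_(N - j) else 0.
Proof. by rewrite coef_poly ltnS. Qed.

Lemma size_conj_rev N p : (size (conj_rev N p) <= N.+1)%N.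
Proof. exact: size_poly. Qed.

Lemma size_conj_rev_eq N p : p`_0 != 0 -> size (conj_rev N p) = N.+1.
Proof.
move=> p0; apply/eqP; rewrite eqn_leq size_conj_rev /=.
rewrite ltnNge; apply/negP => /leq_sizeP/(_ N (leqnn N))/eqP.
by rewrite coef_conj_rev leqnn subnn conjc_eq0 (negbTE p0).
Qed.

(** A ring morphism out of a polynomial ring evaluates the pencil determinant
    of two polynomials with constant coefficients. *)
Lemma mpoly_pencil_det (S : comNzRingType) (f : {rmorphism {mpoly R[i][2]} -> S})
    (g : R[i] -> S) m n (p q : {poly R[i]}) (w v : {mpoly R[i][2]}) :
  (forall c, f c%:MP = g c) ->
  f (pencil_det m n (map_poly (@mpolyC 2 R[i]) p) (map_poly (@mpolyC 2 R[i]) q) w v) =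
  pencil_det m n (map_poly g p) (map_poly g q) (f w) (f v).
Proof.
move=> fg; rewrite rmorph_pencil_det.
have E (r : {poly R[i]}) : map_poly f (map_poly (@mpolyC 2 R[i]) r) = map_poly g r.
  apply/polyP => j; rewrite coef_map coef_map /=.
  by rewrite fg [RHS]coef_map_id0 // -fg mpolyC0 rmorph0.
by rewrite !E.
Qed.

Lemma comp_mpoly_X01 (w v : {mpoly R[i][2]}) :
  ('X_0 \mPo [tuple w; v] = w) * ('X_1 \mPo [tuple w; v] = v).
Proof. by split; rewrite comp_mpolyXU. Qed.

(** Complex conjugation exchanges a polynomial and its conjugate reciprocal up
    to reversal, so that it exchanges the two parameters of the pencil. *)
Lemma pencil_det_conj (S : comNzRingType) (f : {rmorphism R[i] -> S}) m n p (w v : S) :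
  (size p <= (m + n).+1)%N -> let q := conj_rev (m + n) p in
  pencil_det m n (map_poly f (map_poly conjc p)) (map_poly f (map_poly conjc q)) v w =
  pencil_det m n (map_poly f p) (map_poly f q) w v.
Proof.
move=> sp q; apply: pencil_det_rev.
- move=> j; rewrite !coef_map /= coef_conj_rev; case: leqP => jN.
    by rewrite leq_subr subKn.
  by rewrite nth_default ?rmorph0 // (leq_trans sp).
- move=> j; rewrite !coef_map /= coef_conj_rev; case: leqP => jN.
    by rewrite conjcK.
  by rewrite !rmorph0.
- by apply: leq_trans sp; exact: size_poly.
- exact: leq_trans (size_poly _ _) (size_conj_rev _ _).
Qed.

Lemma degree_in_pencil_det m n (p q : {poly R[i]}) (i j : 'I_2) :
  (0 < m + n)%N -> (size p <= (m + n).+1)%N -> size q = (m + n).+1 -> q`_0 != 0 ->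
  i != j ->
  degree_in i (pencil_det m n (map_poly (@mpolyC 2 R[i]) p)
     (map_poly (@mpolyC 2 R[i]) q) 'X_i 'X_j) = (m + n)%N.
Proof.
move=> N0 sp sq q0 ij; apply: degree_inE; apply/eqP; rewrite eqn_leq; apply/andP; split.
  apply: mmeasure_pencil_rows; rewrite mmeasureX /= /mnm_at mnm1E ?eqxx //.
  by rewrite eq_sym (negbTE ij).
pose g k : {poly R[i]} := if k == i then 'X else 0.
set d := pencil_det _ _ _ _ _ _.
apply: (@leq_trans (size (mmap polyC g d))); last first.
  apply: (@size_mmap_leq _ _ (@mnm_at 2 i)) => k; rewrite /g /= /mnm_at mnm1E.
  by case: (k == i); rewrite ?size_polyX ?size_poly0.
rewrite ltnNge; apply/negP => /leq_sizeP/(_ _ (leqnn _))/eqP; apply/negP.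
have := @mpoly_pencil_det _ (mmap polyC g) polyC m n p q 'X_i 'X_j (mmapC _ _).
rewrite /= !mmapX !mmap1U /g eqxx eq_sym (negbTE ij) => fE.
by rewrite [mmap _ _ _]fE; exact: coef_pencil_det_X.
Qed.

Lemma real_meval k (h : {mpoly R[k]}) (v : 'I_k -> R) :
  (h.@[v])%:C = (map_mpoly (real_complex R) h).@[fun i => (v i)%:C].
Proof.
rewrite !mevalE (perm_big _ (msupp_map_mpoly h (@complexI R))) rmorph_sum.
apply: eq_bigr => u _; rewrite rmorphM rmorph_prod /= mcoeff_map_mpoly.
by congr (_ * _); apply: eq_bigr => i _; rewrite rmorphXn.
Qed.

(** The polynomials [h] and [hC] of the theorem: [h] is the resultant at
    [(x + i y, x - i y)], which has real coefficients. *)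
Lemma exists_real_form m n (p : {poly R[i]}) :
  (m <= n)%N -> (0 < n)%N -> size p = (m + n).+1 -> p`_0 != 0 ->
  let q := conj_rev (m + n) p in
  exists h : {mpoly R[2]}, exists hC : {mpoly R[i][2]},
    [/\ complex_form h hC, degree_in 0 hC = (m + n)%N, degree_in 1 hC = (m + n)%N,
        msize h = (2 * n).+1 &
        forall x y : R, (h.@[tnth [tuple x; y]])%:C =
          pencil_det m n p q (x +i* y) (x -i* y)].
Proof.
move=> mn n0 sp p0 q; set N := (m + n)%N.
have ar1 : (n - m <= 2 * n)%N by lia.
have ar2 : (2 * n - (n - m))%N = N by rewrite /N; lia.
have ar3 : (m < n)%N -> (N.+1 <= 2 * n)%N by rewrite /N; lia.
have ar4 : (n <= m)%N -> (2 * n)%N = N by rewrite /N; lia.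
have pN : p`_N != 0 by rewrite -[N]/N.+1.-1 -sp -lead_coefE lead_coef_eq0 -size_poly_gt0 sp.
have sq : size q = N.+1 by exact: size_conj_rev_eq.
have q0 : q`_0 != 0 by rewrite coef_conj_rev subn0 conjc_eq0.
pose P := map_poly (@mpolyC 2 R[i]) p; pose Q := map_poly (@mpolyC 2 R[i]) q.
pose hC := pencil_det m n P Q 'X_0 'X_1.
pose W := ('X_0 + 'i *: 'X_1 : {mpoly R[i][2]}).
pose W' := ('X_0 - 'i *: 'X_1 : {mpoly R[i][2]}).
pose H := pencil_det m n P Q W W'.
have HhC : hC \mPo [tuple W; W'] = H.
  have := @mpoly_pencil_det _ (comp_mpoly [tuple W; W']) (@mpolyC 2 R[i]) m n p q 'X_0 'X_1
    (fun c => comp_mpolyC c _).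
  by rewrite /= (comp_mpoly_X01 W W').1 (comp_mpoly_X01 W W').2.
have conj_i : 0 -i* 1 = - 'i :> R[i] by apply/eqP; rewrite eq_complex /= oppr0 !eqxx.
have conjW : map_mpoly (@conjc R) W = W'.
  by rewrite /W /W' rmorphD /= map_mpolyZ /= !map_mpolyX conj_i scaleNr.
have conjW' : map_mpoly (@conjc R) W' = W.
  by rewrite /W /W' rmorphB /= map_mpolyZ /= !map_mpolyX conj_i scaleNr opprK.
have map_conjC (r : {poly R[i]}) : map_poly (map_mpoly (@conjc R))
     (map_poly (@mpolyC 2 R[i]) r) = map_poly (@mpolyC 2 R[i]) (map_poly conjc r).
  by apply/polyP => j; rewrite !coef_map /= map_mpolyC.
have Hconj : map_mpoly (@conjc R) H = H.
  have := rmorph_pencil_det (map_mpoly (@conjc R)) m n P Q W W'.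
  rewrite /= conjW conjW' => fE; apply: (etrans fE).
  rewrite [map_poly _ P]map_conjC [map_poly _ Q]map_conjC.
  by apply: pencil_det_conj; rewrite sp.
pose h := map_mpoly (complex.Re (R:=R) : {additive R[i] -> R}) H.
have hH : map_mpoly (real_complex R) h = H.
  apply/mpolyP => u; rewrite !mcoeff_map_mpoly /=.
  have : conjc (H@_u) = H@_u by rewrite -[in RHS]Hconj mcoeff_map_mpoly.
  case: (H@_u) => a b [] /eqP; rewrite -subr_eq0 -opprD oppr_eq0 -mulr2n mulrn_eq0 /=.
  by move/eqP ->.
have N0 : (0 < m + n)%N by rewrite addn_gt0 n0 orbT.
exists h, hC; split.
- by rewrite /complex_form hH -HhC.
- by apply: degree_in_pencil_det; rewrite ?sp.
  (* conjugation exchanges the two parameters *)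
- rewrite /hC /P /Q -(pencil_det_conj (@mpolyC 2 R[i])) ?sp //.
  apply: degree_in_pencil_det => //.
  + by rewrite -sp; exact: size_poly.
  + by rewrite size_map_poly.
  + by rewrite coef_map fmorph_eq0.
- rewrite -(mmeasure_map_inj _ h (@complexI R)) hH.
  apply/eqP; rewrite eqn_leq; apply/andP; split.
    apply: mmeasure_pencil_cols => //; apply: (leq_trans (mmeasureD_le _ _ _));
      rewrite geq_max ?mmeasureN (leq_trans (mmeasureZ_le _ _ _)) ?andbT mmeasureX /=
        mdeg1 //.
  (* [lam] is larger in norm than [q`_0 / p`_0] and [q`_N / p`_N] *)
  pose lam : R[i] := `|q`_0 / p`_0| + `|q`_N / p`_N| + 1.
  have lam_gt0 : 0 < lam by rewrite ltr_wpDl ?ltr01 // addr_ge0.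
  have lam0 : lam != 0 by rewrite gt_eqF.
  have lamE : `|lam| = lam by rewrite gtr0_norm.
  have lam1 : q`_0 - lam * p`_0 != 0.
    rewrite subr_eq0; apply/eqP => E.
    have : `|lam| = `|q`_0 / p`_0| by rewrite E mulfK.
    rewrite lamE => E2; have /eqP : `|q`_N / p`_N| + 1 = 0.
      by apply: (addrI `|q`_0 / p`_0|); rewrite addr0 addrA.
    by rewrite gt_eqF // ltr_wpDl ?ltr01.
  have lam2 : q`_N - lam * p`_N != 0.
    rewrite subr_eq0; apply/eqP => E.
    have : `|lam| = `|q`_N / p`_N| by rewrite E mulfK.
    rewrite lamE => E2; have /eqP : `|q`_0 / p`_0| + 1 = 0.
      by apply: (addrI `|q`_N / p`_N|); rewrite addr0 addrCA addrA.
    by rewrite gt_eqF // ltr_wpDl ?ltr01.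
  (* the line on which [x + i y = t] and [x - i y = lam * t] *)
  pose g k : {poly R[i]} := if k == 0 :> 'I_2 then ((1 + lam) / 2) *: 'X
     else ((1 - lam) / (2 * 'i)) *: 'X.
  apply: (@leq_trans (size (mmap polyC g H))); last first.
    apply: (@size_mmap_leq _ _ mdeg) => k; rewrite /g /= mdeg1.
    by case: ifP => _; apply: (leq_trans (size_scale_leq _ _)); rewrite size_polyX.
  rewrite ltnNge; apply/negP => /leq_sizeP/(_ _ (leqnn _))/eqP; apply/negP.
  have := @mpoly_pencil_det _ (mmap polyC g) polyC m n p q W W' (mmapC _ _).
  have i0 : 'i != 0 :> R[i] by rewrite eq_complex /= oner_eq0 andbF.
  have gW : mmap polyC g W = 'X.
    rewrite /W rmorphD /= mmapZ !mmapX !mmap1U /g /= mul_polyC scalerA -scalerDl.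
    by rewrite -[RHS]scale1r; congr (_ *: _); field.
  have gW' : mmap polyC g W' = lam *: 'X.
    rewrite /W' rmorphB /= mmapZ !mmapX !mmap1U /g /= mul_polyC scalerA -scalerBl.
    by congr (_ *: _); field.
  rewrite /= gW gW' => fE.
  rewrite [mmap _ _ _]fE; apply: coef_pencil_det_line => //; rewrite ?sp ?sq //.
    rewrite coefB coefZ coefXnM; case: (ltnP 0 (n - m)) => nm.
      by rewrite mulr0 subr0.
    by move: nm; rewrite leqn0 => /eqP ->.
  rewrite coefB coefZ coefXnM ltnNge ar1 /= ar2.
  case: (ltnP m n) => nm.
    rewrite nth_default; last by rewrite sq ar3.
    by rewrite sub0r oppr_eq0 mulf_neq0.
  by rewrite ar4.
- move=> x y; rewrite real_meval hH.
  pose e (i : 'I_2) : R[i] := (tnth [tuple x; y] i)%:C.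
  have e0 : e 0 = x%:C by [].
  have e1 : e 1 = y%:C by [].
  have eW : meval e W = x +i* y.
    by rewrite /W mevalD mevalZ !mevalXU e0 e1 [RHS]complexE.
  have eW' : meval e W' = x -i* y.
    by rewrite /W' mevalB mevalZ !mevalXU e0 e1 [RHS]complexE /= rmorphN mulrN.
  have := @mpoly_pencil_det _ (meval e) idfun m n p q W W' (mevalC _).
  by rewrite /= eW eW' !map_poly_id.
Qed.

End RealForm.

(** * Greatest common divisors of bivariate polynomials *)

Section Bivariate.
Variable K : fieldType.
Implicit Types (F g A B : {poly {poly K}}) (r s : {poly K}) (x y c : K).

Lemma map_horner_eq0 c g :
  map_poly (horner_eval c) g = 0 -> exists g', g = ('X - c%:P) *: g'.
Proof.
move=> g0; exists (map_poly (fun a : {poly K} => a %/ ('X - c%:P)) g).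
apply/polyP => j; rewrite coefZ coef_map_id0 ?div0p //.
have /eqP : (map_poly (horner_eval c) g)`_j = 0 by rewrite g0 coef0.
by rewrite coef_map /= -/(root _ _) -dvdp_XsubCl mulrC => /divpK.
Qed.

(** Each root [c] of [r] is removed by cancelling [x - c] either in [g] or in both
    cofactors [A] and [B]. *)
Lemma gcd_remove_roots g A B F1 F2 (U V : {poly {poly K}}) r s :
  r != 0 -> s != 0 -> s *: g = U * F1 + V * F2 -> r *: F1 = g * A -> r *: F2 = g * B ->
  exists g' A' B' r' s', [/\ s' != 0, forall x, r'.[x] != 0,
    s' *: g' = U * F1 + V * F2, r' *: F1 = g' * A' & r' *: F2 = g' * B'].
Proof.
move Ek : (size r) => k; elim: k r s g A B Ek => [|k IH] r s g A B sr r0 s0 sg rA rB.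
  by move/eqP: sr; rewrite size_poly_eq0 (negbTE r0).
have [[c rc]|nr] := pselect (exists c, root r c); last first.
  exists g, A, B, r, s; split=> // x; apply/negP => rx; apply: nr; by exists x.
have /factor_theorem[r' Er] := rc.
pose l := 'X - c%:P; have l0 : l != 0 by rewrite polyXsubC_eq0.
have r'0 : r' != 0 by apply: contraNneq r0 => h; rewrite Er h mul0r.
have sr' : size r' = k.
  by move: sr; rewrite Er size_Mmonic ?monicXsubC // size_XsubC addn2 => -[].
have lI F G : l *: F = l *: G -> F = G.
  by rewrite -!mul_polyC; apply: mulfI; rewrite polyC_eq0.
have ev G C : r *: G = g * C -> map_poly (horner_eval c) g = 0 \/ map_poly (horner_eval
  c) C = 0.
  move=> E; have := congr1 (map_poly (horner_eval c)) E.
  rewrite map_polyZ /= {1}/horner_eval (eqP rc) scale0r rmorphM => /esym/eqP.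
  by rewrite mulf_eq0 => /orP[/eqP|/eqP]; [left|right].
have [g0|gn0] := pselect (map_poly (horner_eval c) g = 0).
  have [g' Eg] := map_horner_eq0 g0.
  apply: (IH r' (s * l) g' A B) => //; first by rewrite mulf_neq0.
  - by rewrite -scalerA -Eg.
  - by apply: lI; rewrite scalerAl -Eg -rA Er scalerA mulrC.
  - by apply: lI; rewrite scalerAl -Eg -rB Er scalerA mulrC.
have [A' EA] : exists A', A = l *: A' by case: (ev _ _ rA) => // /map_horner_eq0.
have [B' EB] : exists B', B = l *: B' by case: (ev _ _ rB) => // /map_horner_eq0.
apply: (IH r' s g A' B') => //.
- by apply: lI; rewrite scalerA mulrC -Er rA EA scalerAr.
- by apply: lI; rewrite scalerA mulrC -Er rB EB scalerAr.
Qed.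

(** A greatest common divisor of two bivariate polynomials, up to factors
    depending on the first variable only. The factor [r] can be freed from its
    roots, since [x - c] is a prime element for every [c]. *)
Lemma bivariate_gcd F1 F2 :
  exists g A B (U V : {poly {poly K}}) r s, [/\ s != 0, forall x, r.[x] != 0,
    s *: g = U * F1 + V * F2, r *: F1 = g * A & r *: F2 = g * B].
Proof.
have [[u v] /= /Pdiv.Idomain.eqpP[[c1 c2] /= /andP[c1n c2n] E]] :=
  Pdiv.Idomain.Bezoutp F1 F2.
have [[r1 A] /= r1n E1] := Pdiv.Idomain.dvdpP _ _ (Pdiv.Idomain.dvdp_gcdl F1 F2).
have [[r2 B] /= r2n E2] := Pdiv.Idomain.dvdpP _ _ (Pdiv.Idomain.dvdp_gcdr F1 F2).
have [||||g [A' [B' [r' [s' H]]]]] := @gcd_remove_roots (gcdp F1 F2) (r2 *: A) (r1 *: B)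
  F1 F2
   (c1 *: u) (c1 *: v) (r1 * r2) c2 _ c2n.
- by rewrite mulf_neq0.
- by rewrite -E scalerDr !scalerAl.
- by rewrite mulrC -scalerA E1 scalerAl mulrC.
- by rewrite -scalerA E2 scalerAl mulrC.
by exists g, A', B', (c1 *: u), (c1 *: v), r', s'.
Qed.

End Bivariate.

(** * Polynomial functions on the plane *)

Section PlanePolynomials.
Local Open Scope complex_scope.
Variable R : realType.
Implicit Types (F : {poly {poly R}}) (x y t : R).

(** Value at [(x, y)] of a bivariate real polynomial, viewed as a polynomial in
    the second variable whose coefficients are polynomials in the first one. *)
Definition bieval F x y : R := F.[y%:P].[x].

Lemma bievalD F G x y : bieval (F + G) x y = bieval F x y + bieval G x y.
Proof. by rewrite /bieval !hornerD. Qed.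

Lemma bievalN F x y : bieval (- F) x y = - bieval F x y.
Proof. by rewrite /bieval !hornerN. Qed.

Lemma bievalM F G x y : bieval (F * G) x y = bieval F x y * bieval G x y.
Proof. by rewrite /bieval !hornerM. Qed.

Lemma bievalZ (r : {poly R}) F x y : bieval (r *: F) x y = r.[x] * bieval F x y.
Proof. by rewrite /bieval hornerZ hornerM. Qed.

Lemma bievalC (r : {poly R}) x y : bieval r%:P x y = r.[x].
Proof. by rewrite /bieval hornerC. Qed.

Lemma bievalX x y : bieval 'X x y = y.
Proof. by rewrite /bieval hornerX hornerC. Qed.

Lemma bieval_horner F x y : bieval F x y = (map_poly (horner_eval x) F).[y].
Proof.
rewrite /bieval -[y in RHS](hornerC y x) -[_.[x] in RHS]/(horner_eval x y%:P).
by rewrite horner_map.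
Qed.

(** A complex function of [x + i y] whose real and imaginary parts are
    polynomials in [x] and [y]. *)
Definition polynomial_fun (f : R[i] -> R[i]) :=
  exists F G : {poly {poly R}}, forall x y, f (x +i* y) = bieval F x y +i* bieval G x y.

Lemma polynomial_funD f g : polynomial_fun f -> polynomial_fun g ->
  polynomial_fun (fun z => f z + g z).
Proof.
move=> [F [G fE]] [F' [G' gE]]; exists (F + F'), (G + G') => x y.
by rewrite fE gE !bievalD.
Qed.

Lemma polynomial_funM f g : polynomial_fun f -> polynomial_fun g ->
  polynomial_fun (fun z => f z * g z).
Proof.
move=> [F [G fE]] [F' [G' gE]]; exists (F * F' - G * G'), (F * G' + G * F') => x y.
by rewrite fE gE !bievalD bievalN !bievalM.
Qed.

Lemma polynomial_fun_cst c : polynomial_fun (fun=> c).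
Proof.
by case: c => a b; exists a%:P%:P, b%:P%:P => x y; rewrite !bievalC !hornerC.
Qed.

Lemma polynomial_funX f k : polynomial_fun f -> polynomial_fun (fun z => f z ^+ k).
Proof.
move=> fp; elim: k => [|k IH]; first exact: polynomial_fun_cst 1.
have [F [G E]] := polynomial_funM fp IH.
by exists F, G => x y; rewrite -E exprS.
Qed.

Lemma polynomial_fun_horner f (B : {poly R[i]}) : polynomial_fun f ->
  polynomial_fun (fun z => B.[f z]).
Proof.
move=> fp; elim/poly_ind: B => [|B c IH].
  have [F [G E]] := polynomial_fun_cst 0; exists F, G => x y.
  by rewrite -E horner0.
have [F [G E]] := polynomial_funD (polynomial_funM IH fp) (polynomial_fun_cst c).
by exists F, G => x y; rewrite -E hornerMXaddC.
Qed.

Lemma Re_polynomial (B : {poly R[i]}) n : exists F, forall x y,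
  bieval F x y = complex.Re (B.[x +i* y] * conjc (x +i* y) ^+ n).
Proof.
have idp : polynomial_fun id.
  by exists ('X : {poly R})%:P, 'X => x y; rewrite bievalC hornerX bievalX.
have conjp : polynomial_fun (@conjc R).
  by exists ('X : {poly R})%:P, (- 'X) => x y; rewrite bievalC hornerX bievalN bievalX.
have [F [G E]] := polynomial_funM (polynomial_fun_horner B idp) (polynomial_funX n conjp).
by exists F => x y; rewrite E.
Qed.

Lemma bieval_line F x y x' y' : exists p : {poly R}, forall t,
  p.[t] = bieval F (x + t * x') (y + t * y').
Proof.
elim/poly_ind: F => [|F c [p IH]].
  by exists 0 => t; rewrite /bieval !horner0.
exists (p * (y%:P + y' *: 'X) + (c \Po (x%:P + x' *: 'X))) => t.
rewrite bievalD bievalM bievalC bievalX -IH.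
rewrite hornerD hornerM horner_comp.
by rewrite !(hornerD, hornerZ, hornerC, hornerX) [t * y']mulrC [t * x']mulrC.
Qed.

(** On a line, [Re (B z * conj z ^+ n)] is a real polynomial. *)
Lemma Re_polynomial_line (B : {poly R[i]}) n (z e : R[i]) : exists p : {poly R}, forall t,
  p.[t] = complex.Re (B.[z + t%:C * e] * conjc (z + t%:C * e) ^+ n).
Proof.
case: z e => [x y] [x' y']; have [F FE] := Re_polynomial B n.
have [p pE] := bieval_line F x y x' y'; exists p => t.
rewrite pE FE; congr (complex.Re (B.[_] * conjc _ ^+ n));
  by apply/eqP; rewrite eq_complex /=; apply/andP; split; apply/eqP; ring.
Qed.

Lemma poly_eq_horner (p q : {poly R}) : (forall t, p.[t] = q.[t]) -> p = q.
Proof.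
move=> pq; apply/eqP; rewrite -subr_eq0; apply: contraT => d0.
have := @max_poly_roots _ (p - q) [seq k%:R | k <- iota 0 (size (p - q))] d0.
rewrite size_map size_iota ltnn; apply.
  by apply/allP => x _; rewrite /root !hornerE pq subrr.
rewrite map_inj_uniq ?iota_uniq // => i j /eqP; rewrite eqr_nat => /eqP //.
Qed.

End PlanePolynomials.

(** * The maximum principle *)

Section LocalMaximum.
Local Open Scope complex_scope.
Variable R : realType.
Implicit Types (B : {poly R[i]}) (n : nat) (v : R * R) (x y t : R).

(** The point [(x, y)] as the complex number [x + i y]. *)
Definition toC v : R[i] := v.1 +i* v.2.

(** Square of the Euclidean norm, as opposed to the maximum norm of the plane. *)
Definition sqnorm v : R := v.1 ^+ 2 + v.2 ^+ 2.

Lemma sqnormE v : (sqnorm v)%:C = toC v * conjc (toC v).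
Proof.
by apply/eqP; rewrite eq_complex /toC /sqnorm /=; apply/andP; split; apply/eqP; ring.
Qed.

Lemma sqnorm_ge0 v : 0 <= sqnorm v.
Proof. by rewrite addr_ge0 ?sqr_ge0. Qed.

Lemma toC_eq0 v : (toC v == 0) = (sqnorm v == 0).
Proof.
by rewrite eq_complex /= /sqnorm paddr_eq0 ?sqr_ge0 // !sqrf_eq0.
Qed.

(** The harmonic function [Re (B(z) / z^n)] on the punctured plane, that is, the
    real part of a Laurent polynomial. *)
Definition Re_quot B n v : R := complex.Re (B.[toC v] / toC v ^+ n).

Lemma Re_mul_real (z : R[i]) (a : R) : complex.Re (z * a%:C) = complex.Re z * a.
Proof. by case: z => c d /=; ring. Qed.

Lemma Re_quotE B n v : sqnorm v != 0 ->
  complex.Re (B.[toC v] * conjc (toC v) ^+ n) = Re_quot B n v * sqnorm v ^+ n.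
Proof.
move=> v0; rewrite -Re_mul_real; congr complex.Re.
by rewrite rmorphXn /= sqnormE exprMn mulrA divfK // expf_neq0 // toC_eq0.
Qed.

Lemma near_horner_gt0 (p : {poly R}) : 0 < p.[0] -> \forall t \near (0 : R)^'+, 0 < p.[t].
Proof.
move=> p0; apply: (cvgr_gt p.[0] _ 0 p0).
apply: (@cvg_at_right_filter R R (horner p) 0 p.[0]). exact: continuous_horner.
Qed.

(** A nonconstant [Re (B(z) / z^n)] has no local maximum: near a point [z] the
    leading term of [B(z + h) / (z + h)^n - B(z) / z^n] is a multiple of a power
    [h^k], and the direction of [h] can be chosen to make it positive. *)
Lemma no_local_max B n v :
  sqnorm v != 0 -> (forall c, B != c *: 'X^n) ->
  exists e : R * R, \forall t \near (0 : R)^'+,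
    Re_quot B n v < Re_quot B n (v.1 + t * e.1, v.2 + t * e.2).
Proof.
move=> v0 Bn; set z := toC v; have z0 : z != 0 by rewrite toC_eq0.
pose q := B.[z] / z ^+ n; pose G := B - q *: 'X^n.
have G0 : G != 0 by rewrite subr_eq0.
have [k [G1]] := multiplicity_XsubC G z; rewrite G0 /= => G1z GE.
have k0 : (0 < k)%N.
  rewrite lt0n; apply: contraNneq G1z => k0; rewrite /root.
  have : G.[z] = 0 by rewrite /G !hornerE /q divfK ?subrr // expf_neq0.
  by rewrite GE k0 expr0 mulr1 => ->.
(* [e] is chosen so that [e^k * G1(z) * conj z ^ n = 1] *)
pose c := G1.[z] * conjc z ^+ n.
have c0 : c != 0 by rewrite mulf_neq0 // expf_neq0 // conjc_eq0.
pose e := k.-root c^-1; have ek : e ^+ k = c^-1 by rewrite rootCK.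
have [p pE] := Re_polynomial_line (e ^+ k *: G1) n z e.
have [sp spE] := Re_polynomial_line 'X 1 z e.
pose v' t := (v.1 + t * complex.Re e, v.2 + t * complex.Im e).
have v'E t : toC (v' t) = z + t%:C * e.
  rewrite /toC /v' /z /toC; case: (e) => a b.
  by apply/eqP; rewrite eq_complex /=; apply/andP; split; apply/eqP; ring.
have spE' t : sp.[t] = sqnorm (v' t).
  by rewrite spE -v'E hornerX expr1 -sqnormE.
exists (complex.Re e, complex.Im e) => /=.
have p0 : 0 < p.[0].
  rewrite pE mul0r addr0 hornerZ -mulrA -/c ek mulVf //= ltr01.
have sp0 : 0 < sp.[0].
  by rewrite spE' /v' !mul0r !addr0 lt_def v0 sqnorm_ge0.
near=> t.
have t0 : 0 < t by near: t; exact: nbhs_right_gt.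
have pt : 0 < p.[t].
  by near: t; exact: near_horner_gt0.
have spt : 0 < sp.[t].
  by near: t; exact: near_horner_gt0.
rewrite -/(v' t) -subr_gt0.
have w0 : sqnorm (v' t) != 0 by rewrite -spE' gt_eqF.
have -> : Re_quot B n (v' t) - Re_quot B n v = t ^+ k * p.[t] / sqnorm (v' t) ^+ n.
  apply: (mulIf (expf_neq0 n w0)); rewrite divfK ?expf_neq0 //.
  rewrite mulrBl -Re_quotE // v'E.
  have BE : B.[z + t%:C * e] = G1.[z + t%:C * e] * (t%:C * e) ^+ k + q * (z + t%:C * e)
    ^+ n.
    have -> : B = G1 * ('X - z%:P) ^+ k + q *: 'X^n by rewrite -GE subrK.
    by rewrite hornerD hornerM hornerZ hornerXn horner_exp hornerXsubC addrAC subrr add0r.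
  have -> : B.[z + t%:C * e] * conjc (z + t%:C * e) ^+ n =
      (e ^+ k *: G1).[z + t%:C * e] * conjc (z + t%:C * e) ^+ n * (t ^+ k)%:C +
      q * (sqnorm (v' t) ^+ n)%:C.
    by rewrite BE !rmorphXn /= sqnormE v'E !exprMn hornerZ; ring.
  by rewrite raddfD /= !Re_mul_real -pE [Re_quot _ _ _]/(complex.Re q) addrK mulrC.
by rewrite divr_gt0 ?mulr_gt0 ?exprn_gt0 // -spE'.
Unshelve. all: by end_near.
Qed.

End LocalMaximum.

Section MaximumPrinciple.
Variable R : realType.
Implicit Types (B : {poly R[i]}) (n : nat) (v : R * R) (x y t : R).

Lemma continuous_bieval (F : {poly {poly R}}) :
  continuous (fun v : R * R => bieval F v.1 v.2).
Proof.
elim/poly_ind: F => [|F c IH] v.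
  rewrite (_ : (fun v : R * R => _) = fun=> 0); first exact: cvg_cst.
  by apply/funext => w; rewrite /bieval !horner0.
rewrite (_ : (fun v : R * R => _) = (fun w => bieval F w.1 w.2 * w.2 + c.[w.1])).
  apply: (@cvgD _ R).
    by apply: (@cvgM R); [exact: IH|exact: cvg_snd].
  apply: (@continuous_comp _ _ _ fst (horner c)); first exact: cvg_fst.
  exact: continuous_horner.
by apply/funext => w; rewrite bievalD bievalM bievalX bievalC.
Qed.

Lemma continuous_sqnorm : continuous (@sqnorm R).
Proof.
move=> v; rewrite /sqnorm; apply: (@cvgD _ R).
  by rewrite expr2; apply: (@cvgM R); exact: cvg_fst.
by apply: (@cvgM R); exact: cvg_snd.
Qed.

Lemma continuous_line v (e : R * R) :
   (v.1 + t * e.1, v.2 + t * e.2) @[t --> (0 : R)^'+] --> v.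
Proof.
have L (a c : R) : a + t * c @[t --> (0 : R)] --> a.
  have : a + t * c @[t --> (0 : R)] --> a + 0 * c.
    by apply: (@cvgD _ R); [exact: cvg_cst|apply: (@cvgM R);
      [exact: cvg_id|exact: cvg_cst]].
  by rewrite mul0r addr0.
apply: cvg_at_right_filter; case: v => a b /=.
exact: (cvg_pair (L a e.1) (L b e.2)).
Qed.

Section Domain.
Variables (B : {poly R[i]}) (n : nat) (G : R * R -> R) (delta : R).
Hypothesis Bn : forall c, B != c *: 'X^n.
Hypothesis Gcont : continuous G.
Hypothesis d0 : 0 < delta.
Hypothesis Bcircle : forall v, sqnorm v = 1 -> Re_quot B n v = 0.
Hypothesis Gpos : forall v, 0 < sqnorm v < delta -> 0 < G v.
Hypothesis Gzero : forall v, 0 < sqnorm v < 1 -> G v = 0 -> Re_quot B n v = 0.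

(** The region [G <= 0], kept away from the centre. *)
Let K : set (R * R) := [set v | delta / 2 <= sqnorm v <= 1 /\ G v <= 0].

(** Points of the region that are not on its boundary are not maxima on [K]. *)
Lemma region_ascent v : 0 < sqnorm v < 1 -> G v < 0 ->
  exists2 v', K v' & Re_quot B n v < Re_quot B n v'.
Proof.
move=> /andP[v0 v1] Gv.
have dv : delta / 2 < sqnorm v.
  have : delta <= sqnorm v.
    by rewrite leNgt; apply/negP => h; have := @Gpos v; rewrite v0 h => /(_ isT); lra.
  lra.
have [e near_e] := no_local_max (lt0r_neq0 v0) Bn.
have line := @continuous_line v e.
suff : \forall t \near (0 : R)^'+, K (v.1 + t * e.1, v.2 + t * e.2) /\
     Re_quot B n v < Re_quot B n (v.1 + t * e.1, v.2 + t * e.2).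
  by move=> /filter_ex[t [? ?]]; exists (v.1 + t * e.1, v.2 + t * e.2).
have sqc : sqnorm (v.1 + t * e.1, v.2 + t * e.2) @[t --> (0 : R)^'+] --> sqnorm v.
  exact: (cvg_comp _ _ line (@continuous_sqnorm v)).
have Gc : G (v.1 + t * e.1, v.2 + t * e.2) @[t --> (0 : R)^'+] --> G v.
  exact: (cvg_comp _ _ line (@Gcont v)).
near=> t; split; last by near: t.
split; last by apply: ltW; near: t; exact: cvgr_lt Gc _ Gv.
by apply/andP; split; apply: ltW; near: t; [exact: cvgr_gt sqc _ dv|exact: cvgr_lt sqc _
  v1].
Unshelve. all: by end_near.
Qed.

Let K_compact : compact K.
Proof.
have cK : closed K.
  have -> : K = (@sqnorm R @^-1` [set x | delta / 2 <= x]) `&`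
     (@sqnorm R @^-1` [set x | x <= 1]) `&` (G @^-1` [set x | x <= 0]).
    apply/seteqP; split=> v /=; first by move=> [/andP[]].
    by move=> [[h1 h2] h3]; split=> //; apply/andP.
  apply: closedI; first apply: closedI.
  - by apply: preimage_closed => [v _|]; [exact: continuous_sqnorm|exact: closed_ge].
  - by apply: preimage_closed => [v _|]; [exact: continuous_sqnorm|exact: closed_le].
  - by apply: preimage_closed => [v _|]; [exact: Gcont|exact: closed_le].
apply: (subclosed_compact cK (compact_setX (@segment_compact R (-1) 1) (@segment_compact
  R (-1) 1))).
move=> [x y] [/andP[_]]; rewrite /sqnorm /= => h _; split => /=; rewrite in_itv /=; nra.
Qed.

(** The maximum is attained on the boundary of the region, where the function
    vanishes. *)
Lemma Re_quot_le0 v : K v -> Re_quot B n v <= 0.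
Proof.
move=> Kv.
have [w /set_mem Kw wmax] : exists2 c, c \in K & forall u : R * R, u \in K ->
  Re_quot B n u <= Re_quot B n c.
  apply: compact_EVT_max => //; first by exists v.
  have [F FE] := Re_polynomial B n.
  pose f (w : R * R) := bieval F w.1 w.2 / sqnorm w ^+ n.
  apply: (@subspace_eq_continuous _ _ _ f).
    move=> u /set_mem[/andP[u1 _] _]; have u0 : sqnorm u != 0 by rewrite gt_eqF //
      (lt_le_trans _ u1) ?divr_gt0.
    by rewrite /f FE Re_quotE // mulfK // expf_neq0.
  apply: continuous_in_subspaceT => u /set_mem[/andP[u1 _] _].
  have u0 : sqnorm u != 0 by rewrite gt_eqF // (lt_le_trans _ u1) ?divr_gt0.
  apply: (@cvgM R); first exact: continuous_bieval.
  apply: (@cvgV R); first by rewrite expf_neq0.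
  have : ('X^n).[sqnorm w] @[w --> u] --> ('X^n).[sqnorm u].
    apply: (cvg_comp _ _ (@continuous_sqnorm u)); exact: continuous_horner.
  rewrite hornerXn (_ : (fun w => ('X^n).[sqnorm w]) = (fun w => sqnorm w ^+ n)) //.
  by apply/funext => w; rewrite hornerXn.
apply: (le_trans (wmax _ (mem_set Kv))).
have [/andP[w1 w2] Gw] := Kw.
have w0 : 0 < sqnorm w by rewrite (lt_le_trans _ w1) ?divr_gt0.
move: w2; rewrite le_eqVlt => /orP[/eqP w2|w2]; first by rewrite Bcircle.
move: Gw; rewrite le_eqVlt => /orP[/eqP Gw|Gw].
  by rewrite Gzero // w0.
have [|w' Kw' /lt_geF] := region_ascent _ Gw; first by rewrite w0.
by rewrite wmax ?mem_set.
Qed.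

End Domain.

Lemma Re_quotN B n v : Re_quot (- B) n v = - Re_quot B n v.
Proof. by rewrite /Re_quot hornerN mulNr raddfN. Qed.

(** If [Re (B(z) / z^n)] vanishes on the unit circle and at the zeros of [G] in
    the open disc, and [G] is positive near the centre, then [G] is nonnegative on
    the disc: a nonconstant harmonic function cannot vanish on the boundary of the region
    where [G] is negative. *)
Lemma nonneg_in_disc (B : {poly R[i]}) n (G : R * R -> R) (delta : R) :
  (forall c, B != c *: 'X^n) -> continuous G -> 0 < delta ->
  (forall v, sqnorm v = 1 -> Re_quot B n v = 0) ->
  (forall v, 0 < sqnorm v < delta -> 0 < G v) ->
  (forall v, 0 < sqnorm v < 1 -> G v = 0 -> Re_quot B n v = 0) ->
  forall v, 0 < sqnorm v < 1 -> 0 <= G v.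
Proof.
move=> Bn Gc d0 B1 Gp Gz v v01; rewrite leNgt; apply/negP => Gv.
have NBn c : - B != c *: 'X^n by rewrite eqr_oppLR -scaleNr.
have le0 := Re_quot_le0 Bn Gc d0 B1 Gp Gz.
have ge0 w : delta / 2 <= sqnorm w <= 1 /\ G w <= 0 -> 0 <= Re_quot B n w.
  move=> Kw; rewrite -oppr_le0 -Re_quotN.
  by apply: (Re_quot_le0 NBn Gc d0 _ Gp _ Kw) => [u /B1|u /Gz uG /uG];
    rewrite Re_quotN => ->; rewrite oppr0.
have Kv : delta / 2 <= sqnorm v <= 1 /\ G v <= 0.
  have /andP[v0 v1] := v01; split; last exact: ltW.
  rewrite (ltW v1) andbT leNgt; apply/negP => vd.
  by have := Gp v; rewrite v0 (lt_trans vd) ?ltr_pdivrMr ?ltr_pMr ?ltr1n // ltNge (ltW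
    Gv) => /(_ isT).
have [w Kw] := region_ascent Bn Gc Gp v01 Gv.
have := le0 _ Kw; have := ge0 _ Kv; lra.
Qed.

End MaximumPrinciple.

(** * Zeros of a nonnegative divisor *)

Section SecondOrderZeros.
Local Open Scope complex_scope.
Variable R : realType.
Implicit Types (B : {poly R[i]}) (n : nat) (v : R * R) (x y t : R).

(** Near a zero of [Re (B(z) / z^n)] which is not a critical point of
    [B(z) / z^n], the zero is of first order along some direction. *)
Lemma first_order_zero B n v :
  sqnorm v != 0 -> ~~ root ('X * B^`() - n%:R *: B) (toC v) -> Re_quot B n v = 0 ->
  exists (e : R * R) (p : {poly R}), p.[0] != 0 /\
    forall t, complex.Re (B.[toC (v.1 + t * e.1, v.2 + t * e.2)] *
       conjc (toC (v.1 + t * e.1, v.2 + t * e.2)) ^+ n) = t * p.[t].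
Proof.
move=> v0; set z := toC v => crit Bv; have z0 : z != 0 by rewrite toC_eq0.
pose q := B.[z] / z ^+ n; pose G := B - q *: 'X^n.
have Gz : root G z by rewrite /root /G !hornerE /q divfK ?subrr // expf_neq0.
have /factor_theorem[G1 GE] := Gz.
have BE : B = G1 * ('X - z%:P) + q *: 'X^n by rewrite -GE subrK.
have G1z : G1.[z] != 0.
  apply: contra crit => /eqP G1z; rewrite /root.
  have -> : B^`() = G1^`() * ('X - z%:P) + G1 + q *: ('X^(n.-1) *+ n).
    by rewrite {1}BE derivD derivM derivXsubC mulr1 derivZ derivXn.
  have Bz : B.[z] = q * z ^+ n by rewrite /q divfK // expf_neq0.
  rewrite !(hornerD, hornerN, hornerM, hornerZ, hornerX, hornerMn, hornerXn, hornerC).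
  rewrite Bz G1z subrr !mulr0 !add0r.
  case: (n) => [|k]; first by rewrite mulr0n !mulr0 mul0r subrr.
  by rewrite /= exprS; apply/eqP; rewrite -mulr_natl; ring.
pose c := G1.[z] * conjc z ^+ n.
have c0 : c != 0 by rewrite mulf_neq0 // expf_neq0 // conjc_eq0.
pose e := c^-1.
have [p pE] := Re_polynomial_line (e *: G1) n z e.
exists (complex.Re e, complex.Im e), p; split=> [|t].
  by rewrite pE mul0r addr0 hornerZ -mulrA -/c mulVf //= oner_eq0.
set w := toC _; have wE : w = z + t%:C * e.
  rewrite /w /z /toC /=; case: (e) => a b.
  by apply/eqP; rewrite eq_complex /=; apply/andP; split; apply/eqP; ring.
have -> : B.[w] * conjc w ^+ n =
    (e *: G1).[z + t%:C * e] * conjc (z + t%:C * e) ^+ n * t%:C +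
      q * (sqnorm (v.1 + t * complex.Re e, v.2 + t * complex.Im e) ^+ n)%:C.
  have Bw : B.[w] = G1.[w] * (w - z) + q * w ^+ n.
    by rewrite {1}BE hornerD hornerM hornerZ hornerXn hornerXsubC.
  have wz : w - z = t%:C * e by rewrite wE addrAC subrr add0r.
  by rewrite Bw wz -wE rmorphXn /= sqnormE -/w !exprMn hornerZ; ring.
rewrite raddfD /= !Re_mul_real -pE -[complex.Re q]/(Re_quot B n v) Bv mul0r addr0.
by rewrite mulrC.
Qed.

Lemma crit_poly_neq0 B n : (forall c, B != c *: 'X^n) -> 'X * B^`() - n%:R *: B != 0.
Proof.
move=> Bn; apply/eqP => E; have /eqP := Bn B`_n; apply; apply/polyP => j.
rewrite coefZ coefXn; case: (eqVneq j n) => [->|jn]; first by rewrite mulr1.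
have := congr1 (fun p : {poly R[i]} => p`_j) E.
rewrite coefB coefZ coef0 coefXM coef_deriv; case: j jn => [|j] jn /=.
  rewrite sub0r mulr0 => /eqP; rewrite oppr_eq0 mulf_eq0 pnatr_eq0.
  by rewrite eq_sym (negbTE jn) => /eqP.
rewrite mulr0 -[B`_j.+1 *+ _]mulr_natl -mulrBl => /eqP;
  rewrite mulf_eq0 subr_eq0 eqr_nat (negbTE jn).
by move/eqP.
Qed.

(** A real polynomial without zeros in a punctured disc has a constant sign
    there. *)
Lemma punctured_disc_sign (g : {poly {poly R}}) (delta : R) (a : R) :
  0 < a -> a ^+ 2 < delta ->
  (forall v, 0 < sqnorm v < delta -> bieval g v.1 v.2 != 0) ->
  forall v, 0 < sqnorm v < delta -> 0 < bieval g a 0 * bieval g v.1 v.2.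
Proof.
move=> a0 ad gn0.
(* the sign is the same at the ends of a segment avoiding the origin *)
have seg v w : 0 < sqnorm v < delta -> 0 < sqnorm w < delta ->
    (forall t, 0 < t < 1 -> 0 < sqnorm (v.1 + t * (w.1 - v.1), v.2 + t * (w.2 - v.2))) ->
    0 < bieval g v.1 v.2 * bieval g w.1 w.2.
  move=> hv hw avoid.
  rewrite lt_def mulf_neq0 ?gn0 //= leNgt; apply/negP => neg.
  have [p pE] := bieval_line g v.1 v.2 (w.1 - v.1) (w.2 - v.2).
  have p01 : p.[0] * p.[1] < 0.
    by rewrite !pE !mul0r !mul1r !addr0 ![_ + (_ - _)]addrC !subrK.
  have [t t01 /eqP]   := polyrcf.poly_ivtoo ler01 p01.
  rewrite in_itv /= in t01; rewrite pE; apply/eqP.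
  apply: (gn0 (v.1 + t * (w.1 - v.1), v.2 + t * (w.2 - v.2))).
  rewrite avoid //=; move: hv hw t01 => /andP[_ hv] /andP[_ hw] /andP[t0 t1].
  rewrite /sqnorm /= in hv hw *.
  set s := 1 - t; have s0 : 0 < s by rewrite subr_gt0.
  have -> : (v.1 + t * (w.1 - v.1)) ^+ 2 + (v.2 + t * (w.2 - v.2)) ^+ 2 =
     s * (v.1 ^+ 2 + v.2 ^+ 2) + t * (w.1 ^+ 2 + w.2 ^+ 2)
     - s * t * ((v.1 - w.1) ^+ 2 + (v.2 - w.2) ^+ 2) by rewrite /s; ring.
  have : 0 <= s * t * ((v.1 - w.1) ^+ 2 + (v.2 - w.2) ^+ 2).
    by rewrite !mulr_ge0 ?(ltW s0) ?(ltW t0) // addr_ge0 ?sqr_ge0.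
  have : s * (v.1 ^+ 2 + v.2 ^+ 2) < s * delta by rewrite ltr_pM2l.
  have : t * (w.1 ^+ 2 + w.2 ^+ 2) < t * delta by rewrite ltr_pM2l.
  have : s * delta + t * delta = delta by rewrite /s; ring.
  lra.
have ha : 0 < sqnorm (a, 0) < delta.
  by rewrite /sqnorm /= expr0n addr0 ad exprn_gt0.
have hb : 0 < sqnorm (0, a) < delta.
  by rewrite /sqnorm /= expr0n add0r ad exprn_gt0.
move=> v hv; have [v2|v2] := eqVneq v.2 0; last first.
  apply: (seg (a, 0) v) => // t /andP[t0 t1]; rewrite lt_def sqnorm_ge0 andbT.
  rewrite -toC_eq0 eq_complex /= negb_and; apply/orP; right.
  by rewrite subr0 add0r mulf_neq0 ?(gt_eqF t0) ?(gt_eqF a0).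
have v1 : v.1 != 0.
  by move: hv => /andP[+ _]; rewrite /sqnorm v2 expr0n addr0 => /lt0r_neq0;
    rewrite sqrf_eq0.
(* when [v] is on the first axis, the path goes through [(0, a)] *)
have s1 : 0 < bieval g a 0 * bieval g 0 a.
  apply: (seg (a, 0) (0, a)) => // t /andP[t0 t1]; rewrite lt_def sqnorm_ge0 andbT.
  rewrite -toC_eq0 eq_complex /= negb_and; apply/orP; right.
  by rewrite subr0 add0r mulf_neq0 ?(gt_eqF t0) ?(gt_eqF a0).
have s2 : 0 < bieval g 0 a * bieval g v.1 v.2.
  apply: (seg (0, a) v) => // t /andP[t0 t1]; rewrite lt_def sqnorm_ge0 andbT.
  rewrite -toC_eq0 eq_complex /= negb_and; apply/orP; left.
  by rewrite subr0 add0r mulf_neq0 ?(gt_eqF t0) ?(gt_eqF a0).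
have b0 : 0 < bieval g 0 a ^+ 2 by rewrite exprn_even_gt0 //= (gn0 (0, a)).
rewrite -(pmulr_lgt0 _ b0); have := mulr_gt0 s1 s2.
by congr (0 < _); ring.
Qed.

Lemma finite_root (K : idomainType) (p : {poly K}) : p != 0 ->
  finite_set [set x | root p x].
Proof.
move=> p0; apply: contrapT => /(@infinite_set_fset _ _ (size p))[X Xp].
apply/negP; rewrite -ltnNge.
apply: (max_poly_roots p0) (finmap.fset_uniq X).
by apply/allP => x xX; exact: Xp.
Qed.

(** At a zero of a nonnegative polynomial [g], a multiple of [g] vanishes to
    second order, so that the zero is a critical point of [B(z) / z^n]. *)
Lemma second_order_zero (g A F : {poly {poly R}}) (r : {poly R}) B n v :
  (forall x y, bieval F x y = complex.Re (B.[x +i* y] * conjc (x +i* y) ^+ n)) ->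
  (forall x, r.[x] != 0) -> r *: F = g * A ->
  (forall w, 0 < sqnorm w < 1 -> 0 <= bieval g w.1 w.2) ->
  0 < sqnorm v < 1 -> bieval g v.1 v.2 = 0 ->
  root ('X * B^`() - n%:R *: B) (toC v).
Proof.
move=> FE r0 rF g_ge0 /andP[v0 v1] gv.
have rFE w : r.[w.1] * bieval F w.1 w.2 = bieval g w.1 w.2 * bieval A w.1 w.2.
  by rewrite -bievalZ rF bievalM.
apply: contraT => crit.
have Bv : Re_quot B n v = 0.
  have vn0 : sqnorm v != 0 by rewrite gt_eqF.
  have := rFE v; rewrite gv mul0r => /eqP; rewrite mulf_eq0 (negbTE (r0 _)) /= FE.
  by rewrite -[_ +i* _]/(toC v) Re_quotE // mulf_eq0 expf_eq0 (negbTE vn0) andbF orbF =>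
    /eqP.
have [e [p [p0 pE]]] := first_order_zero (lt0r_neq0 v0) crit Bv.
have [gl glE] := bieval_line g v.1 v.2 e.1 e.2.
have [Al AlE] := bieval_line A v.1 v.2 e.1 e.2.
have [rl rlE] := bieval_line r%:P v.1 v.2 e.1 e.2.
have /factor_theorem[g1 g1E] : root gl 0 by rewrite /root glE !mul0r !addr0 gv.
rewrite subr0 in g1E.
have E : rl * p = g1 * Al.
  apply: (@mulfI _ 'X); first by rewrite polyX_eq0.
  apply: poly_eq_horner => t; have := rFE (v.1 + t * e.1, v.2 + t * e.2).
  rewrite FE -[_ +i* _]/(toC (v.1 + t * e.1, v.2 + t * e.2)) pE /=.
  rewrite -glE -AlE g1E !(hornerM, hornerX) rlE bievalC => H.
  by rewrite mulrCA H; ring.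
have g10 : g1.[0] != 0.
  have : (rl * p).[0] != 0 by rewrite hornerM mulf_neq0 // rlE bievalC mul0r addr0.
  by rewrite E hornerM; apply: contraNneq => ->; rewrite mul0r.
(* otherwise [g] would change sign on the line through [v] of direction [e] *)
have sign s : s = 1 \/ s = -1 -> 0 <= s * g1.[0].
  move=> s1; rewrite leNgt; apply/negP => neg.
  pose e' := (s * e.1, s * e.2).
  have line := @continuous_line R v e'.
  have sqc : sqnorm (v.1 + t * e'.1, v.2 + t * e'.2) @[t --> (0 : R)^'+] --> sqnorm v.
    exact: (cvg_comp _ _ line (@continuous_sqnorm R v)).
  have near1 := @near_horner_gt0 R (- (s *: (g1 \Po (s *: 'X)))).
  have : \forall t \near (0 : R)^'+, False.
    near=> t.
    have t0 : 0 < t by near: t; exact: nbhs_right_gt.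
    have st : 0 < (- (s *: (g1 \Po (s *: 'X)))).[t].
      by near: t; apply: near1; rewrite hornerN hornerZ horner_comp hornerZ hornerX mulr0
        oppr_gt0.
    have := g_ge0 (v.1 + t * e'.1, v.2 + t * e'.2).
    have -> : 0 < sqnorm (v.1 + t * e'.1, v.2 + t * e'.2) < 1.
      by apply/andP; split; near: t; [exact: cvgr_gt sqc _ v0|exact: cvgr_lt sqc _ v1].
    rewrite /= !mulrA -glE g1E hornerM hornerX => /(_ isT).
    move: st; rewrite hornerN hornerZ horner_comp hornerZ hornerX oppr_gt0 => st.
    have -> : g1.[t * s] * (t * s) = t * (s * g1.[s * t]) by rewrite [t * s]mulrC; ring.
    by rewrite leNgt pmulr_rlt0 // st.
  by move/filter_ex => [].
have := sign 1 (or_introl erefl); have := sign (-1) (or_intror erefl).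
by rewrite mul1r mulN1r oppr_ge0 => h1 h2; case/eqP: g10; apply/eqP; rewrite eq_le h1.
Unshelve. all: by end_near.
Qed.

End SecondOrderZeros.

(** * Finiteness of the common zeros *)

Section Finiteness.
Local Open Scope complex_scope.
Variable R : realType.

Lemma bieval_eq0 (B : {poly R[i]}) n (F : {poly {poly R}}) (v : R * R) :
  (forall x y, bieval F x y = complex.Re (B.[x +i* y] * conjc (x +i* y) ^+ n)) ->
  0 < sqnorm v -> (bieval F v.1 v.2 == 0) = (Re_quot B n v == 0).
Proof.
move=> FE v0; have vn0 := lt0r_neq0 v0.
by rewrite FE -[_ +i* _]/(toC v) Re_quotE // mulf_eq0 expf_eq0 (negbTE vn0) andbF orbF.
Qed.

(** Two functions [Re (B(z) / z^n)] have finitely many common zeros in the open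
    unit disc. If [g] is a greatest common divisor of the polynomials defining
    them, [g] does not vanish near the centre, so that it is positive there up to
    sign, hence nonnegative on the disc; its zeros are thus of order two, and are
    critical points of [B1(z) / z^n]. The vertical lines where [g] may miss common
    zeros are treated separately: a chord of common zeros would contradict the
    maximum principle. *)
Theorem finite_common_zeros (B1 B2 : {poly R[i]}) n (delta : R) :
  0 < delta -> (forall c, B1 != c *: 'X^n) ->
  (forall v : R * R, sqnorm v = 1 -> Re_quot B1 n v = 0) ->
  (forall v : R * R, 0 < sqnorm v < delta ->
     ~ (Re_quot B1 n v = 0 /\ Re_quot B2 n v = 0)) ->
  finite_set [set v : R * R | 0 < sqnorm v < 1 /\
     (Re_quot B1 n v = 0 /\ Re_quot B2 n v = 0)].
Proof.
move=> d0 Bn B1circle near0.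
have [F1 F1E] := Re_polynomial B1 n; have [F2 F2E] := Re_polynomial B2 n.
have Z1 v := @bieval_eq0 B1 n F1 v F1E; have Z2 v := @bieval_eq0 B2 n F2 v F2E.
have [g0 [A0 [B0 [U0 [V0 [r [s [s0 rn0 sg0 rA0 rB0]]]]]]]] := bivariate_gcd F1 F2.
pose a := Num.min delta 1 / 2.
have m0 : 0 < Num.min delta 1 by rewrite lt_min d0 ltr01.
have a0 : 0 < a by rewrite divr_gt0.
have ad : a ^+ 2 < delta.
  have h1 : Num.min delta 1 <= 1 by rewrite ge_min lexx orbT.
  have h2 : Num.min delta 1 <= delta by rewrite ge_min lexx.
  rewrite /a; nra.
have gsub (g A B : {poly {poly R}}) : r *: F1 = g * A -> r *: F2 = g * B ->
    forall v, 0 < sqnorm v -> bieval g v.1 v.2 = 0 ->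
      Re_quot B1 n v = 0 /\ Re_quot B2 n v = 0.
  move=> rA rB v v0 gv.
  split; apply/eqP; rewrite -?Z1 -?Z2 // -(mulrI_eq0 _ (mulfI (rn0 v.1))) -bievalZ ?rA ?rB;
    by rewrite bievalM gv mul0r.
have [g [A [B [U [V [sg rA rB ga]]]]]] : exists g A B U V, [/\ s *: g = U * F1 + V * F2,
    r *: F1 = g * A, r *: F2 = g * B & 0 < bieval g a 0].
  have : bieval g0 a 0 != 0.
    apply/eqP => g00; apply: (near0 (a, 0)); first by rewrite /sqnorm /= expr0n addr0 ad
      exprn_gt0.
    by apply: (gsub _ _ _ rA0 rB0) => //; rewrite /sqnorm /= expr0n addr0 exprn_gt0.
  rewrite neq_lt => /orP[neg|pos]; last by exists g0, A0, B0, U0, V0.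
  exists (- g0), (- A0), (- B0), (- U0), (- V0); split; rewrite ?mulrNN //.
    by rewrite scalerN sg0 opprD !mulNr.
  by rewrite bievalN oppr_gt0.
have g_neq0 v : 0 < sqnorm v < delta -> bieval g v.1 v.2 != 0.
  move=> hv; apply/eqP => gv; apply: (near0 v hv).
  by apply: (gsub _ _ _ rA rB) => //; case/andP: hv.
have g_ge0 : forall w : R * R, 0 < sqnorm w < 1 -> 0 <= bieval g w.1 w.2.
  apply: (@nonneg_in_disc R B1 n (fun w => bieval g w.1 w.2) delta) => //.
  - exact: continuous_bieval.
  - by move=> v /(punctured_disc_sign a0 ad g_neq0); rewrite pmulr_rgt0.
  - by move=> v /andP[v0 _] gv; have [] := gsub _ _ _ rA rB v v0 gv.
(* zeros of [g] *)
pose S1 := [set v : R * R | root ('X * B1^`() - n%:R *: B1) (toC v)].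
have finS1 : finite_set S1.
  rewrite (_ : S1 = @toC R @^-1` [set z | root ('X * B1^`() - n%:R *: B1) z]) //.
  apply: finite_preimage; last by apply: finite_root; exact: crit_poly_neq0.
  by move=> [x y] [x' y'] _ _ [-> ->].
(* common zeros on one of the vertical lines [x = c], [c] a root of [s] *)
pose L c := [set (c, y) | y in [set y |
   root (map_poly (horner_eval c) F1) y && root (map_poly (horner_eval c) F2) y]].
pose S2 := \bigcup_(c in [set c | root s c /\ c ^+ 2 < 1]) L c.
have finS2 : finite_set S2.
  apply: bigcup_finite.
    apply: (@sub_finite_set _ _ [set c | root s c]); first by move=> c [].
    exact: finite_root.
  move=> c [_ c1]; apply: finite_image.
  have [F1c|] := eqVneq (map_poly (horner_eval c) F1) 0; last first.
    move=> /finite_root; apply: sub_finite_set => y /= /andP[] //.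
  have [F2c|] := eqVneq (map_poly (horner_eval c) F2) 0; last first.
    move=> /finite_root; apply: sub_finite_set => y /= /andP[] //.
  exfalso.
  have line v : 0 < sqnorm v -> v.1 = c -> Re_quot B1 n v = 0 /\ Re_quot B2 n v = 0.
    move=> v0 vc; split; apply/eqP; rewrite -?Z1 -?Z2 // bieval_horner vc;
    by rewrite ?F1c ?F2c horner0.
  have c0 : c != 0.
    apply/eqP => c0; apply: (near0 (0, a)); first by rewrite /sqnorm /= expr0n add0r ad
      exprn_gt0.
    by apply: line => //; rewrite /sqnorm /= expr0n add0r exprn_gt0.
  have cn0 : 0 < `|c| by rewrite normr_gt0.
  have c2 : c ^+ 2 = `|c| ^+ 2 by rewrite real_normK ?num_real.
  have cn1 : `|c| < 1 by rewrite -(ltr_pXn2r (_ : 0 < 2)%N) ?nnegrE // expr1n -c2.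
  have := @nonneg_in_disc R B1 n (fun w => 1 - w.1 / c) (c ^+ 2) Bn.
  have contG : continuous (fun w : R * R => 1 - w.1 / c).
    move=> w; apply: (@cvgB _ R); first exact: cvg_cst.
    by apply: (@cvgM R); [exact: cvg_fst|exact: cvg_cst].
  have c2_gt0 : 0 < c ^+ 2 by rewrite c2 exprn_gt0.
  move=> /(_ contG c2_gt0 B1circle) nonneg.
  (* the point [(l * c, 0)] of the disc lies beyond the chord *)
  pose l := (1 + `|c|^-1) / 2.
  have cVn : `|c|^-1 * `|c| = 1 by rewrite mulVf // gt_eqF.
  have cVn1 : 1 < `|c|^-1 by rewrite invf_gt1.
  have [] // : ~ (0 <= 1 - (l * c) / c).
    by rewrite mulfK // subr_ge0 /l; lra.
  apply: (nonneg _ _ (l * c, 0)).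
  - move=> v /andP[_ vc]; rewrite subr_gt0.
    have : (v.1 / c) ^+ 2 < 1.
      rewrite expr_div_n ltr_pdivrMr // mul1r; apply: le_lt_trans vc.
      by rewrite /sqnorm lerDl sqr_ge0.
    nra.
  - move=> v /andP[v0 _] /eqP; rewrite subr_eq0 => /eqP E.
    by have [] // := line v v0; rewrite -[v.1](divfK c0) -E mul1r.
  - rewrite /sqnorm /= expr0n addr0 exprMn c2 -exprMn /l mulrAC mulrDl mul1r cVn.
    have := normr_ge0 c; nra.
apply: (@sub_finite_set _ _ (S1 `|` S2)); last by rewrite finite_setU.
move=> v [/andP[v0 v1] [z1 z2]].
have F1v : bieval F1 v.1 v.2 = 0 by apply/eqP; rewrite Z1 // z1.
have F2v : bieval F2 v.1 v.2 = 0 by apply/eqP; rewrite Z2 // z2.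
have : s.[v.1] * bieval g v.1 v.2 = 0.
  by rewrite -bievalZ sg bievalD !bievalM F1v F2v !mulr0 addr0.
move/eqP; rewrite mulf_eq0 => /orP[sv|/eqP gv]; last first.
  by left; apply: (second_order_zero F1E rn0 rA g_ge0); rewrite ?v0.
right; exists v.1; first by split=> //; apply: le_lt_trans v1;
  rewrite /sqnorm lerDl sqr_ge0.
by exists v.2; [rewrite /= /root -!bieval_horner F1v F2v eqxx|case: (v)].
Qed.

End Finiteness.

(** * Values of a Laurent polynomial at symmetric points *)

Section Laurent.
Local Open Scope complex_scope.
Variables (R : realType) (m n : nat) (a : int -> R[i]).
Hypotheses (n_gt0 : (0 < n)%N) (an_neq0 : a n%:Z != 0).

Let N := (m + n)%N.

(** The polynomial [z^m * p(z)]. *)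
Definition laurent_num : {poly R[i]} := \poly_(j < N.+1) a (j%:Z - m%:Z).
Let P := laurent_num.
Let Q := conj_rev N P.
Let L := laurent m n a.
(** The point symmetric to [z] about the unit circle. *)
Let refl (z : R[i]) := (conjc z)^-1.

Lemma coef_num0 : P`_0 = a (- m%:Z).
Proof. by rewrite coef_poly sub0r. Qed.

Lemma coef_numN : P`_N = a n%:Z.
Proof. by rewrite coef_poly ltnSn /N PoszD addrAC subrr add0r. Qed.

Lemma size_num : size P = N.+1.
Proof.
apply/eqP; rewrite eqn_leq size_poly ltnNge; apply/negP => /leq_sizeP/(_ N (leqnn N))/eqP.
by rewrite coef_numN (negbTE an_neq0).
Qed.

Lemma horner_num z : z != 0 -> P.[z] = z ^+ m * L z.
Proof.
move=> z0; rewrite horner_poly /L /laurent mulr_sumr; apply: eq_bigr => j _.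
rewrite mulrCA; congr (_ * _).
by rewrite -[z ^+ m]/(z ^ m%:Z) -expfzDr // addrC subrK.
Qed.

Lemma horner_conj_rev z : z != 0 -> Q.[z] = z ^+ n * conjc (L (refl z)).
Proof.
move=> z0; have r0 : refl z != 0 by rewrite invr_eq0 conjc_eq0.
have -> : Q.[z] = z ^+ N * conjc (P.[refl z]).
  rewrite horner_poly (horner_coef_wide _ (eq_leq size_num)) rmorph_sum mulr_sumr.
  rewrite (reindex_inj rev_ord_inj); apply: eq_bigr => j _ /=.
  rewrite subSS (subKn (leq_ord j)) rmorphM rmorphXn /= mulrCA; congr (_ * _).
  rewrite /refl rmorphV ?unitfE ?conjc_eq0 //= conjcK.
  by rewrite -[X in _ = z ^+ X * _](subnK (leq_ord j)) exprD exprVn mulfK // expf_neq0.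
rewrite horner_num // rmorphM rmorphXn /= /refl rmorphV ?unitfE ?conjc_eq0 //= conjcK.
by rewrite /N exprD exprVn mulrCA !mulrA mulVf ?mul1r // expf_neq0.
Qed.

Lemma conj_rev0 : Q`_0 != 0.
Proof. by rewrite coef_conj_rev subn0 conjc_eq0 coef_numN. Qed.

(** The resultant at [(w, conj w)] vanishes exactly when [w] is a common value
    of the Laurent polynomial at two points symmetric about the circle. *)
Lemma pencil_det_eq0 w :
  pencil_det m n P Q w (conjc w) = 0 <-> exists z, [/\ z != 0, L z = w & L (refl z) = w].
Proof.
have N_gt : (m < N)%N by rewrite /N -[X in (X < _)%N]addn0 ltn_add2l.
have n_le : (n <= N)%N by rewrite leq_addl.
have szP : size (P - w *: 'X^m) = N.+1.
  rewrite size_polyDl ?size_num // size_polyN; apply: (leq_ltn_trans (size_scale_leq _ _)).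
  by rewrite size_polyXn ltnS.
have szQ : (size (Q - conjc w *: 'X^n)%R <= N.+1)%N.
  apply: (leq_trans (size_polyD _ _)); rewrite geq_max size_conj_rev size_polyN.
  by apply: (leq_trans (size_scale_leq _ _)); rewrite size_polyXn.
split.
  move=> /(det_sylvester_common_root szP szQ)[z].
  rewrite /root !hornerE => Pz Qz.
  have z0 : z != 0.
    apply: contraTneq Qz => ->; rewrite expr0n eqn0Ngt n_gt0 mulr0 subr0 horner_coef0.
    exact: conj_rev0.
  exists z; split=> //.
    apply: (mulfI (expf_neq0 m z0)); rewrite -horner_num //.
    by apply/eqP; rewrite -subr_eq0 [_ * w]mulrC.
  apply: (can_inj (@conjcK _)); apply: (mulfI (expf_neq0 n z0));
    rewrite -horner_conj_rev //.
  by apply/eqP; rewrite -subr_eq0 [_ * conjc w]mulrC.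
move=> [z [z0 Lz Lrz]]; apply: (@det_sylvester_root _ _ _ _ z) => //.
- exact: leq_trans N_gt.
- by rewrite szP.
- by rewrite /root !hornerE horner_num // Lz mulrC subrr.
- by rewrite /root !hornerE horner_conj_rev // Lrz mulrC subrr.
Qed.

Lemma laurent_circle_bound : exists C : R, forall z, `|z| = 1 -> `|L z| <= C%:C.
Proof.
exists (complex.Re (\sum_(j < N.+1) `|a (j%:Z - m%:Z)|)) => z z1.
rewrite RRe_real; last by apply: ger0_real; exact: sumr_ge0.
apply: (le_trans (ler_norm_sum _ _ _)); apply: ler_sum => j _.
by rewrite normrM; case: (j%:Z - m%:Z) => k; rewrite /exprz ?normfV normrX z1 expr1n
  ?invr1 mulr1.
Qed.

End Laurent.

(** * Behaviour near the centre *)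

Section Domination.
Local Open Scope complex_scope.
Variable R : realType.

Lemma polynomial_fun_conj (f : R[i] -> R[i]) :
  polynomial_fun f -> polynomial_fun (fun z => conjc (f z)).
Proof. by move=> [F [G fE]]; exists F, (- G) => x y; rewrite fE bievalN. Qed.

Lemma dominated_near0 (S T : {poly R[i]}) : `|S.[0]| < `|T.[0]| ->
  exists2 delta : R, 0 < delta &
    forall v : R * R, sqnorm v < delta -> `|S.[toC v]| < `|T.[toC v]|.
Proof.
move=> ST.
have idp : polynomial_fun (@id R[i]).
  by exists ('X : {poly R})%:P, 'X => x y; rewrite bievalC hornerX bievalX.
have normp (U : {poly R[i]}) := polynomial_funM (polynomial_fun_horner U idp)
  (polynomial_fun_conj (polynomial_fun_horner U idp)).
have [F1 [G1 E1]] := normp S; have [F2 [G2 E2]] := normp T.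
have normE (U : {poly R[i]}) F G : (forall x y,
  U.[x +i* y] * conjc U.[x +i* y] = bieval F x y +i* bieval G x y) ->
   forall v, `|U.[toC v]| ^+ 2 = (bieval F v.1 v.2)%:C.
  move=> E v; have h : `|U.[toC v]| ^+ 2 = (bieval F v.1 v.2) +i* (bieval G v.1 v.2).
    by rewrite sqr_normc E.
  have : complex.Im (`|U.[toC v]| ^+ 2) = 0 by apply: ger0_Im; rewrite exprn_ge0.
  by rewrite h /= => ->.
have n1 := normE _ _ _ E1; have n2 := normE _ _ _ E2.
have cmp v : (`|S.[toC v]| < `|T.[toC v]|) = (0 < bieval (F2 - F1) v.1 v.2).
  rewrite -(ltr_pXn2r (_ : 0 < 2)%N) ?nnegrE // n1 n2 ltcR.
  by rewrite bievalD bievalN subr_gt0.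
have F0 : 0 < bieval (F2 - F1) 0 0.
  by rewrite -(cmp (0, 0)).
have := @continuous_bieval R (F2 - F1) (0, 0).
move=> /(cvgr_gt _) /(_ _ F0) /nbhs_ballP[e /= e0 eF].
exists (e ^+ 2); first exact: exprn_gt0.
move=> v ve; rewrite cmp; apply: eF; split; rewrite /= /ball /= sub0r normrN.
  rewrite -(ltr_pXn2r (_ : 0 < 2)%N) ?nnegrE ?(ltW e0) // real_normK ?num_real //.
  by apply: le_lt_trans ve; rewrite lerDl sqr_ge0.
rewrite -(ltr_pXn2r (_ : 0 < 2)%N) ?nnegrE ?(ltW e0) // real_normK ?num_real //.
by apply: le_lt_trans ve; rewrite lerDr sqr_ge0.
Qed.

End Domination.

(** * Points symmetric about the circle with the same value *)

Section SymmetricPairs.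
Local Open Scope complex_scope.
Variables (R : realType) (m n : nat) (L : R[i] -> R[i]) (P Q : {poly R[i]}).
Hypotheses (n_gt0 : (0 < n)%N) (mn : (m <= n)%N) (Q0 : Q`_0 != 0) (PN : P`_(m + n) != 0).
Hypothesis hornerP : forall z, z != 0 -> P.[z] = z ^+ m * L z.
Hypothesis hornerQ : forall z, z != 0 -> Q.[z] = z ^+ n * conjc (L (conjc z)^-1).

(** Equal values at [z] and [1 / conj z] give [|z^(n - m) * P z| = |Q z|], whereas
    [P] is multiplied by a factor vanishing at [0]. *)
Lemma no_symmetric_pair_lt : (m < n)%N ->
  exists2 delta : R, 0 < delta & forall v : R * R,
    0 < sqnorm v < delta -> L (toC v) <> L (conjc (toC v))^-1.
Proof.
move=> ltmn.
have [|delta d0 dom] := @dominated_near0 R ('X^(n - m) * P) Q.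
  rewrite hornerM hornerXn expr0n subn_eq0 leqNgt ltmn mul0r normr0 normr_gt0.
  by rewrite horner_coef0.
exists delta; first exact: d0.
move=> v /andP[v0 vd] Lv; have z0 : toC v != 0 by rewrite toC_eq0 gt_eqF.
have := dom v vd; rewrite hornerM hornerXn (hornerP z0) (hornerQ z0) -Lv.
by rewrite mulrA -exprD (subnK mn) !normrM normcJ ltxx.
Qed.

Lemma no_symmetric_pair_bounded (M : R) :
  (forall z, z != 0 -> L z = L (conjc z)^-1 -> `|L z| <= M%:C) ->
  exists2 delta : R, 0 < delta & forall v : R * R,
    0 < sqnorm v < delta -> L (toC v) <> L (conjc (toC v))^-1.
Proof.
move=> LM.
have [|delta d0 dom] := @dominated_near0 R (M%:C *: 'X^n) Q.
  rewrite hornerZ hornerXn expr0n eqn0Ngt n_gt0 mulr0 normr0 normr_gt0.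
  by rewrite horner_coef0.
exists delta; first exact: d0.
move=> v /andP[v0 vd] Lv; have z0 : toC v != 0 by rewrite toC_eq0 gt_eqF.
have := dom v vd; rewrite hornerZ hornerXn (hornerQ z0) -Lv.
rewrite !normrM normcJ mulrC ltr_pM2l ?normr_gt0 ?expf_neq0 //.
move=> /lt_geF; rewrite (le_trans (LM _ z0 Lv)) //.
by rewrite real_ler_norm //; apply/complex_realP; exists M.
Qed.

(** The numerator of [c * p(z) - conj (c * p(1 / conj z))], whose real part is
    that of [c * (p(z) - p(1 / conj z))]. *)
Let B c := c *: ('X^(n - m) * P) - conjc c *: Q.

Lemma Re_quot_laurent c (v : R * R) : sqnorm v != 0 ->
  Re_quot (B c) n v = complex.Re (c * (L (toC v) - L (conjc (toC v))^-1)).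
Proof.
move=> v0; have z0 : toC v != 0 by rewrite toC_eq0.
have zn0 := expf_neq0 n z0; rewrite /Re_quot /B.
have -> : (c *: ('X^(n - m) * P) - conjc c *: Q).[toC v] / toC v ^+ n =
    c * L (toC v) - conjc (c * L (conjc (toC v))^-1).
  rewrite !(hornerD, hornerN, hornerZ, hornerM, hornerXn) (hornerP z0) (hornerQ z0).
  rewrite [_ ^+ (n - m) * _]mulrA -exprD subnK // rmorphM /=; field.
  by rewrite ?zn0 ?z0.
by rewrite mulrBr !raddfB /=; congr (_ - _); case: (_ * _).
Qed.

Lemma common_zero_laurent (v : R * R) : sqnorm v != 0 ->
  (Re_quot (B 1) n v = 0 /\ Re_quot (B 'i) n v = 0) <-> L (toC v) = L (conjc (toC v))^-1.
Proof.
move=> v0; rewrite (Re_quot_laurent 1 v0) (Re_quot_laurent 'i v0).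
split=> [|->]; last by rewrite subrr !mulr0.
move: (L _) (L _) => [x y] [x' y'] [] /=.
rewrite !(mul0r, mul1r, sub0r, subr0) => /eqP + /eqP.
by rewrite oppr_eq0 !subr_eq0 => /eqP -> /eqP ->.
Qed.

(** Not both [B 1] and [B 'i] are multiples of ['X^n], since the coefficients
    [u] of [P] in degree [m + n] and [v] of [Q] in degree [2n] would satisfy [u = v] and [i u = - i v], and [u <> 0]. *)
Lemma symmetric_nonconstant :
  (forall c, B 1 != c *: 'X^n) \/ (forall c, B 'i != c *: 'X^n).
Proof.
have coefB c : (B c)`_(2 * n) = c * P`_(m + n) - conjc c * Q`_(2 * n).
  rewrite /B coefB !coefZ coefXnM ltnNge (_ : (n - m <= 2 * n)%N) /=; last by lia.
  by rewrite (_ : (2 * n - (n - m))%N = (m + n)%N) //; lia.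
have coefZX c : (c *: 'X^n : {poly R[i]})`_(2 * n) = 0.
  by rewrite coefZ coefXn (_ : _ == _ = false) ?mulr0 //; apply/eqP; lia.
have [|b1] := eqVneq ((B 1)`_(2 * n)) 0; last first.
  by left=> c; apply: contraNneq b1 => ->; rewrite coefZX.
rewrite coefB conjc1 !mul1r => /eqP; rewrite subr_eq0 => /eqP E.
right=> c; apply: contraNneq PN => Bi; have := coefZX c; rewrite -Bi coefB -E.
have -> : conjc 'i = - 'i :> R[i] by apply/eqP; rewrite eq_complex /= oppr0 !eqxx.
rewrite mulNr opprK -mulr2n -mulr_natl mulrA => /eqP; rewrite !mulf_eq0 pnatr_eq0 /=.
by rewrite eq_complex /= oner_eq0 andbF.
Qed.

(** One of two symmetric points off the circle is in the open disc, so the values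
    taken at such pairs come from the zeros in the disc. *)
Lemma finite_off_circle (V : set (R * R)) (delta : R) :
  (forall v, V v -> exists z, [/\ z != 0, L z = toC v & L (conjc z)^-1 = toC v]) ->
  0 < delta -> (forall v : R * R, 0 < sqnorm v < delta ->
    L (toC v) <> L (conjc (toC v))^-1) ->
  finite_set (V `\` [set toR2 (L z) | z in unit_circle R]).
Proof.
move=> VE d0 near0; pose refl (z : R[i]) := (conjc z)^-1.
have zeroE := common_zero_laurent.
pose Z := [set v : R * R | 0 < sqnorm v < 1 /\
     (Re_quot (B 1) n v = 0 /\ Re_quot (B 'i) n v = 0)].
have finZ : finite_set Z.
  have B0 c (v : R * R) : sqnorm v = 1 -> Re_quot (B c) n v = 0.
    move=> v1; rewrite Re_quot_laurent; last by rewrite v1 oner_eq0.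
    have -> : (conjc (toC v))^-1 = toC v.
      apply: (@mulIf _ (conjc (toC v))); last by rewrite mulVf -?sqnormE ?v1 // conjc_eq0
        toC_eq0 v1 oner_eq0.
      by rewrite conjc_eq0 toC_eq0 v1 oner_eq0.
    by rewrite subrr mulr0.
  have no0 (v : R * R) : 0 < sqnorm v < delta ->
      ~ (Re_quot (B 1) n v = 0 /\ Re_quot (B 'i) n v = 0).
    by move=> hv /zeroE h; apply: (near0 v hv); apply: h; case/andP: hv => /lt0r_neq0.
  have [Bn|Bn] := symmetric_nonconstant.
    exact: finite_common_zeros d0 Bn (B0 1) no0.
  have := @finite_common_zeros R (B 'i) (B 1) n delta d0 Bn (B0 'i).
  move=> /(_ (fun v hv h => no0 v hv (conj (proj2 h) (proj1 h)))).
  by apply: sub_finite_set => v [? [? ?]].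
apply: (@sub_finite_set _ _ [set toR2 (L (toC v)) | v in Z]); last exact: finite_image.
move=> w [/VE[z [z0 Lz Lrz]] nw].
have toCK (u : R[i]) : toC (toR2 u) = u by case: u.
have toR2K (u : R * R) : toR2 (toC u) = u by case: u.
pose s u : R := sqnorm (toR2 u).
have sE u : (s u)%:C = `|u| ^+ 2 by rewrite sqr_normc sqnormE toCK.
have s_gt0 u : u != 0 -> 0 < s u by move=> u0; rewrite lt_def sqnorm_ge0 -toC_eq0 toCK u0.
have inZ u : u != 0 -> s u < 1 -> L u = L (refl u) -> Z (toR2 u).
  move=> u0 u1 Lu; split; first by rewrite s_gt0.
  by apply/zeroE; rewrite ?toCK // gt_eqF // s_gt0.
have [s1|s1|s1] := ltgtP (s z) 1.
- by exists (toR2 z); [apply: inZ; rewrite // Lz Lrz|rewrite toCK Lz toR2K].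
- have r0 : refl z != 0 by rewrite invr_eq0 conjc_eq0.
  exists (toR2 (refl z)); last by rewrite toCK Lrz toR2K.
  apply: inZ => //; last by rewrite /refl conjc_inv conjcK invrK Lz -/(refl z) Lrz.
  rewrite -ltcR sE normfV normcJ exprVn -sE -rmorphV ?unitfE ?gt_eqF ?s_gt0 //.
  by rewrite ltcR invf_lt1 // s_gt0.
- exfalso; apply: nw; exists z; last by rewrite Lz toR2K.
  rewrite /unit_circle /=; apply/eqP; rewrite -sqrp_eq1 ?normr_ge0 //.
  by rewrite -sE s1.
Qed.

(** The set [V] of the values taken at two points symmetric about the circle. *)
Section ValueSet.
Variable V : set (R * R).
Hypothesis VE : forall v, V v <-> exists z, [/\ z != 0,
  L z = toC v & L (conjc z)^-1 = toC v].
Let pT := [set toR2 (L z) | z in unit_circle R].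

Let toR2K (u : R[i]) : toC (toR2 u) = u. Proof. by case: u. Qed.

Lemma circle_sub_values : pT `<=` V.
Proof.
move=> _ [z z1 <-]; apply/VE; exists z; rewrite toR2K.
have z0 : z != 0 by rewrite -normr_eq0 z1 oner_eq0.
have zz : z * conjc z = 1 by rewrite -sqr_normc z1 expr1n.
have -> : (conjc z)^-1 = z.
  by apply: (mulIf (_ : conjc z != 0)); rewrite ?conjc_eq0 // mulVf ?conjc_eq0.
by split.
Qed.

Lemma finite_values_lt : (m < n)%N -> finite_set (V `\` pT).
Proof.
move=> ltmn; have [delta d0 near0] := no_symmetric_pair_lt ltmn.
exact: finite_off_circle (fun v => proj1 (VE v)) d0 near0.
Qed.

Lemma finite_values_bounded : bounded_set V -> finite_set (V `\` pT).
Proof.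
move=> [M [_ bV]].
have [|delta d0 near0] := @no_symmetric_pair_bounded (2 * (M + 1)); last first.
  exact: finite_off_circle (fun v => proj1 (VE v)) d0 near0.
move=> z z0 Lz.
have vM : V (toR2 (L z)) by apply/VE; exists z; rewrite toR2K -Lz.
have /= := bV (M + 1) _ _ vM; rewrite ltrDl ltr01
  prodnormedzmodule.ProdNormedZmodule.prod_normE ge_max.
move=> /(_ isT)/andP[]; case: (L z) => x y /= xM yM.
have M0 := le_trans (normr_ge0 x) xM.
rewrite -(ler_pXn2r (_ : 0 < 2)%N) ?nnegrE ?normr_ge0 ?ler0c ?mulr_ge0 //.
have := sqnormE (x, y); rewrite /toC /= -sqr_normc => <-.
rewrite -rmorphXn /= lecR /sqnorm /= -(real_normK (num_real x)) -(real_normK (num_real y)).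
have := normr_ge0 x; have := normr_ge0 y; nra.
Qed.

Lemma bounded_values (C : R) : (forall z, `|z| = 1 -> `|L z| <= C%:C) ->
  finite_set (V `\` pT) -> bounded_set V.
Proof.
move=> LC finV.
have bT : bounded_set pT.
  exists C; split=> [|M CM _ [z /LC LzC <-]]; first exact: num_real.
  rewrite /= prodnormedzmodule.ProdNormedZmodule.prod_normE ge_max.
  have h (x : R) : `|x|%:C <= `|L z| -> `|x| <= M.
    by move=> xL; apply: le_trans (ltW CM); rewrite -lecR; exact: le_trans LzC.
  rewrite (h _ (normc_ge_Re _)) h //.
  have := normc_ge_Re (L z * 'i); rewrite ReiNIm normrN normrM.
  by rewrite (_ : `|'i| = 1) ?mulr1 // normc_def /= expr0n expr1n add0r sqrtr1.
have bF := compact_bounded (finite_compact finV).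
have -> : V = (V `\` pT) `|` pT by rewrite setUC setDUK //; exact: circle_sub_values.
move: bF bT => [MF [_ hF]] [MT [_ hT]]; exists (Num.max MF MT); split;
  first exact: num_real.
by move=> M; rewrite gt_max => /andP[MFM MTM] v [/(hF _ MFM)|/(hT _ MTM)].
Qed.

End ValueSet.

End SymmetricPairs.

Unset Implicit Arguments.

(** * The zero set of the resultant *)

Theorem theorem2p1 (R : realType) (m n : nat) (a : int -> R[i])
    (n_ge1 : (1 <= n)%N) (m_le_n : (m <= n)%N)
    (a_neq0 : a (- m%:Z) * a n%:Z != 0) :
  exists h : {mpoly R[2]},
    let V : set (R * R) := zero_set h in
    let pT : set (R * R) :=
      [set toR2 (laurent m n a z) | z in unit_circle R] in
    msize h = (2 * n).+1 /\
    pT `<=` V /\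
    (exists hC : {mpoly R[i][2]},
        complex_form h hC /\
        degree_in 0 hC = (m + n)%N /\ degree_in 1 hC = (m + n)%N) /\
    ((m < n)%N -> finite_set (V `\` pT)) /\
    (m = n -> (finite_set (V `\` pT) <-> bounded_set V)).
Proof.
move: a_neq0; rewrite mulf_eq0 negb_or => /andP[am an].
have sP := size_num m an.
have P0 : (laurent_num m n a)`_0 != 0 by rewrite coef_num0.
have PN : (laurent_num m n a)`_(m + n) != 0 by rewrite coef_numN.
have [h [hC [hform deg0 deg1 hsize hE]]] := exists_real_form m_le_n n_ge1 sP P0.
have VE v : zero_set h v <-> exists z, [/\ z != 0, laurent m n a z = toC v &
    laurent m n a (conjc z)^-1 = toC v].
  apply: iff_trans (pencil_det_eq0 m n_ge1 an (toC v)).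
  rewrite -[pencil_det _ _ _ _ _ _]hE /zero_set /=.
  by split=> [->//|/complexI].
have Q0 := conj_rev0 m an.
have hP := @horner_num R m n a.
have hQ := horner_conj_rev m an.
exists h => V pT; split; first exact: hsize.
split; first exact: circle_sub_values VE.
split; first exact: (ex_intro _ hC (conj hform (conj deg0 deg1))).
have fin_lt := finite_values_lt n_ge1 m_le_n Q0 PN hP hQ VE.
split; first exact: fin_lt.
have fin_bd := finite_values_bounded n_ge1 m_le_n Q0 PN hP hQ VE.
have [C LC] := laurent_circle_bound m n a.
have bd_fin := bounded_values VE LC.
by split; [exact: bd_fin|exact: fin_bd].
Qed.
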